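(* Let $(A,\alpha)$ be an action of a locally compact group $G$ on a $C^*$-algebra $A$, and let $(A\rtimes_\alpha G,i_A,i_G)$ be its usual full crossed product (universal for nondegenerate covariant homomorphisms). Then $(i_A,i_G)$ is also universal among degenerate covariant homomorphisms: for any degenerate covariant homomorphism $(\pi,u)$ of $(A,\alpha)$ to a $C^*$-algebra $B$, there is a unique homomorphism $\pi\times u:A\rtimes_\alpha G\to M(B)$ satisfying $$(\pi\times u)\bigl(i_A(a)i_G(c)\bigr)=\pi(a)u(c)\quad\text{for all }a\in A,\ c\in C^*(G).$$
   Context: Homomorphisms are $*$-homomorphisms. A degenerate covariant homomorphism of an action $(A,\alpha)$ to a $C^*$-algebra $B$ is a pair $(\pi,u)$, where $\pi:A\to M(B)$ is a homomorphism (allowed, but not required, to be degenerate) and $u:G\to M(B)$ is a strictly continuous unitary homomorphism such that $\pi\circ\alpha_s=\mathrm{Ad}\,u_s\circ\pi$ for all $s\in G$. It is nondegenerate if $\pi:A\to M(B)$ is nondegenerate. The same letter $u$ denotes the associated nondegenerate homomorphism $u:C^*(G)\to M(B)$ (and similarly for $i_G$). The usual crossed product $(A\rtimes_\alpha G,i_A,i_G)$ consists of a $C^*$-algebra and a nondegenerate covariant homomorphism $(i_A,i_G)$ of $(A,\alpha)$ to $A\rtimes_\alpha G$ (with $A\rtimes_\alpha G=\overline{\mathrm{span}}\,i_A(A)i_G(C^*(G))$) such that for every nondegenerate covariant homomorphism $(\pi,u)$ of $(A,\alpha)$ to a $C^*$-algebra $B$ there is a unique homomorphism $\pi\times u:A\rtimes_\alpha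 G\to M(B)$ with $(\pi\times u)(i_A(a)i_G(c))=\pi(a)u(c)$ for all $a\in A$, $c\in C^*(G)$. *)

(* Defs.v *)
From HB Require Import structures.
From mathcomp Require Import all_boot all_order all_algebra.
From mathcomp Require Import all_classical all_reals all_analysis.
From mathcomp.real_closed Require Import complex.

Set Implicit Arguments.
Unset Strict Implicit.
Unset Printing Implicit Defensive.

Import Order.TTheory GRing.Theory Num.Theory.
Import numFieldNormedType.Exports.

Local Open Scope classical_set_scope.
Local Open Scope complex_scope.
Local Open Scope ring_scope.

(* MathComp's ring hierarchy is unital, hence this separate structure for
   associative complex *-algebras without unit. *)
HB.mixin Record isStarAlgebra (R : realType) A & GRing.Lmodule R[i] A := {
  amul : A -> A -> A;
  star : A -> A;
  amulA : associative amul;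
  amulDl : left_distributive amul +%R;
  amulDr : right_distributive amul +%R;
  amulZl : forall (c : R[i]) x y, amul (c *: x) y = c *: amul x y;
  amulZr : forall (c : R[i]) x y, amul x (c *: y) = c *: amul x y;
  starK : involutive star;
  starD : {morph star : x y / x + y};
  starZ : forall (c : R[i]) x, star (c *: x) = conjc c *: star x;
  starM : forall x y, star (amul x y) = amul (star y) (star x)
}.

#[short(type="starAlgType")]
HB.structure Definition StarAlgebra (R : realType) :=
  {A of GRing.Lmodule R[i] A & isStarAlgebra R A}.

Notation "x ** y" := (amul x y) (at level 40, left associativity) : ring_scope.

(* The norm of a normed module over R[i] takes its values in R[i]; these
   values are nonnegative, hence real. *)
HB.mixin Record isCStarAlgebra (R : realType) A
    & StarAlgebra R A & CompleteNormedModule R[i] A := {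
  normAM_le : forall x y : A, `|x ** y| <= `|x| * `|y|;
  normA_star : forall x : A, `|star x ** x| = `|x| ^+ 2
}.

#[short(type="cstarAlgType")]
HB.structure Definition CStarAlgebra (R : realType) :=
  {A of StarAlgebra R A & CompleteNormedModule R[i] A & isCStarAlgebra R A}.

Record star_hom (R : realType) (A B : starAlgType R) (f : A -> B) : Prop := {
  star_hom_linear : linear f;
  star_homM : {morph f : x y / x ** y};
  star_homS : {morph f : x / star x}
}.

Definition closed_span (R : realType) (V : normedModType R[i]) (S : set V) :
    set V :=
  closure [set v | exists n (c : 'I_n -> R[i]) (x : 'I_n -> V),
                     (forall i, S (x i)) /\ v = \sum_(i < n) c i *: x i].

(* The multiplier algebra M(B), as the *-algebra of double centralizers (L, R)
   of B.  The single condition a L(b) = R(a) b forces L and R to be linear and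
   bounded, L(ab) = L(a) b and R(ab) = a R(b). *)
Record multiplier (R : realType) (B : cstarAlgType R) := Multiplier {
  mulL : B -> B;
  mulR : B -> B;
  multiplierP : forall a b, a ** mulL b = mulR a ** b
}.

Section MultiplierTheory.
Variables (R : realType) (B : cstarAlgType R).
Implicit Types (a b x y : B) (S T U : multiplier B) (c : R[i]).

Lemma amul0l x : (0 : B) ** x = 0.
Proof. by rewrite -(scale0r (0 : B)) amulZl !scale0r. Qed.

Lemma amulNl x y : (- x) ** y = - (x ** y).
Proof. by rewrite -scaleN1r amulZl scaleN1r. Qed.

Lemma amulNr x y : x ** (- y) = - (x ** y).
Proof. by rewrite -scaleN1r amulZr scaleN1r. Qed.

Lemma star_amul_eq0 x : star x ** x = 0 -> x = 0.
Proof.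
move=> h; have := normA_star x; rewrite h normr0 => /esym/eqP.
by rewrite sqrf_eq0 normr_eq0 => /eqP.
Qed.

Lemma amulIl x y : (forall a, a ** x = a ** y) -> x = y.
Proof.
move=> h; apply/eqP; rewrite -subr_eq0; apply/eqP/star_amul_eq0.
by rewrite amulDr amulNr h subrr.
Qed.

Lemma amulIr x y : (forall a, x ** a = y ** a) -> x = y.
Proof.
move=> h; apply: (inv_inj (@starK R B)); apply: amulIl => a.
by rewrite -[a]starK -!starM h.
Qed.

Lemma mulL_linear T : linear (mulL T).
Proof.
move=> c x y; apply: amulIl => a.
by rewrite multiplierP !amulDr !amulZr -!multiplierP.
Qed.

Lemma mulR_linear T : linear (mulR T).
Proof.
move=> c x y; apply: amulIr => a.
by rewrite -multiplierP !amulDl !amulZl -!multiplierP.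
Qed.

Lemma mulLD T x y : mulL T (x + y) = mulL T x + mulL T y.
Proof. by have := mulL_linear T 1 x y; rewrite !scale1r. Qed.

Lemma mulRD T x y : mulR T (x + y) = mulR T x + mulR T y.
Proof. by have := mulR_linear T 1 x y; rewrite !scale1r. Qed.

Lemma mulL0 T : mulL T 0 = 0.
Proof. by apply: (addrI (mulL T 0)); rewrite -mulLD !addr0. Qed.

Lemma mulR0 T : mulR T 0 = 0.
Proof. by apply: (addrI (mulR T 0)); rewrite -mulRD !addr0. Qed.

Lemma mulLZ T c x : mulL T (c *: x) = c *: mulL T x.
Proof. by have := mulL_linear T c x 0; rewrite mulL0 !addr0. Qed.

Lemma mulRZ T c x : mulR T (c *: x) = c *: mulR T x.
Proof. by have := mulR_linear T c x 0; rewrite mulR0 !addr0. Qed.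

Lemma multiplier_ext S T : mulL S =1 mulL T -> mulR S =1 mulR T -> S = T.
Proof.
case: S T => [l r p] [l' r' p'] /= /funext hl /funext hr; subst l' r'.
by congr Multiplier; exact: Prop_irrelevance.
Qed.

HB.instance Definition _ := gen_eqMixin (multiplier B).
HB.instance Definition _ := gen_choiceMixin (multiplier B).

Fact madd_subproof S T a b :
  a ** (mulL S b + mulL T b) = (mulR S a + mulR T a) ** b.
Proof. by rewrite amulDr amulDl !multiplierP. Qed.
Definition madd S T := Multiplier (madd_subproof S T).

Fact mzero_subproof a b : a ** (0 : B) = 0 ** b.
Proof. by rewrite amul0l -(scale0r (0 : B)) amulZr !scale0r. Qed.
Definition mzero := Multiplier mzero_subproof.

Fact mscale_subproof c T a b : a ** (c *: mulL T b) = (c *: mulR T a) ** b.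
Proof. by rewrite amulZr amulZl multiplierP. Qed.
Definition mscale c T := Multiplier (mscale_subproof c T).

Fact mopp_subproof T a b : a ** (- mulL T b) = (- mulR T a) ** b.
Proof. by rewrite amulNr amulNl multiplierP. Qed.
Definition mopp T := Multiplier (mopp_subproof T).

Fact mmul_subproof S T a b :
  a ** mulL S (mulL T b) = mulR T (mulR S a) ** b.
Proof. by rewrite !multiplierP. Qed.
Definition mmul S T := Multiplier (mmul_subproof S T).

Fact mstar_subproof T a b :
  a ** star (mulR T (star b)) = star (mulL T (star a)) ** b.
Proof.
rewrite -[a in LHS]starK -starM -multiplierP.
by rewrite starM starK.
Qed.
Definition mstar T := Multiplier (mstar_subproof T).

Definition mone : multiplier B := @Multiplier R B id id (fun _ _ => erefl).

Fact membed_subproof x a b : a ** (x ** b) = (a ** x) ** b.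
Proof. exact: amulA. Qed.
Definition membed x := Multiplier (membed_subproof x).

Fact maddA : associative madd.
Proof. by move=> S T U; apply: multiplier_ext => x /=; rewrite addrA. Qed.
Fact maddC : commutative madd.
Proof. by move=> S T; apply: multiplier_ext => x /=; rewrite addrC. Qed.
Fact madd0 : left_id mzero madd.
Proof. by move=> S; apply: multiplier_ext => x /=; rewrite add0r. Qed.
Fact maddN : left_inverse mzero mopp madd.
Proof. by move=> S; apply: multiplier_ext => x /=; rewrite addNr. Qed.
HB.instance Definition _ :=
  GRing.isZmodule.Build (multiplier B) maddA maddC madd0 maddN.

Fact mscaleA c d T : mscale c (mscale d T) = mscale (c * d) T.
Proof. by apply: multiplier_ext => x /=; rewrite scalerA. Qed.
Fact mscale1 : left_id 1 mscale.
Proof. by move=> T; apply: multiplier_ext => x /=; rewrite scale1r. Qed.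
Fact mscaleDr : right_distributive mscale +%R.
Proof. by move=> c S T; apply: multiplier_ext => x /=; rewrite scalerDr. Qed.
Fact mscaleDl T : {morph mscale^~ T : c d / c + d}.
Proof. by move=> c d; apply: multiplier_ext => x /=; rewrite scalerDl. Qed.
HB.instance Definition _ := GRing.Zmodule_isLmodule.Build R[i] (multiplier B)
  mscaleA mscale1 mscaleDr mscaleDl.

Fact mmulA : associative mmul.
Proof. by move=> S T U; apply: multiplier_ext. Qed.
Fact mmulDl : left_distributive mmul +%R.
Proof. by move=> S T U; apply: multiplier_ext => x //=; rewrite mulRD. Qed.
Fact mmulDr : right_distributive mmul +%R.
Proof. by move=> S T U; apply: multiplier_ext => x //=; rewrite mulLD. Qed.
Fact mmulZl c S T : mmul (c *: S) T = c *: mmul S T.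
Proof. by apply: multiplier_ext => x //=; rewrite mulRZ. Qed.
Fact mmulZr c S T : mmul S (c *: T) = c *: mmul S T.
Proof. by apply: multiplier_ext => x //=; rewrite mulLZ. Qed.
Fact mstarK : involutive mstar.
Proof. by move=> T; apply: multiplier_ext => x /=; rewrite !starK. Qed.
Fact mstarD : {morph mstar : S T / S + T}.
Proof. by move=> S T; apply: multiplier_ext => x /=; rewrite starD. Qed.
Fact mstarZ c T : mstar (c *: T) = conjc c *: mstar T.
Proof. by apply: multiplier_ext => x /=; rewrite starZ. Qed.
Fact mstarM S T : mstar (mmul S T) = mmul (mstar T) (mstar S).
Proof. by apply: multiplier_ext => x /=; rewrite !starK. Qed.
HB.instance Definition _ := isStarAlgebra.Build R (multiplier B)
  mmulA mmulDl mmulDr mmulZl mmulZr mstarK mstarD mstarZ mstarM.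

End MultiplierTheory.

Arguments mone {R B}.

Definition nondegenerate (R : realType) (A B : cstarAlgType R)
    (pi : A -> multiplier B) : Prop :=
  closed_span [set y | exists a b, y = mulL (pi a) b] = [set: B].

HB.mixin Record isLocallyCompactGroup G & Topological G & Group G := {
  mulg_continuous : continuous (fun xy : G * G => (xy.1 * xy.2)%g);
  invg_continuous : continuous (fun x : G => (x^-1)%g);
  lcgroup_hausdorff : hausdorff_space G;
  lcgroup_locally_compact : locally_compact [set: G]
}.

#[short(type="lcGroupType")]
HB.structure Definition LocallyCompactGroup :=
  {G of Topological G & Group G & isLocallyCompactGroup G}.

Section GroupDefs.
Variables (R : realType) (G : lcGroupType).

(* Each alpha s is an automorphism: its inverse is alpha (s^-1). *)
Record is_action (A : cstarAlgType R) (alpha : G -> A -> A) : Prop := {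
  action_hom : forall s, star_hom (alpha s);
  action1 : forall a, alpha 1%g a = a;
  actionM : forall s t a, alpha (s * t)%g a = alpha s (alpha t a);
  action_continuous : forall a, continuous (fun s => alpha s a)
}.

Record strict_unitary_hom (B : cstarAlgType R) (u : G -> multiplier B) :
    Prop := {
  uhomM : forall s t, u (s * t)%g = u s ** u t;
  uhom_unitaryl : forall s, star (u s) ** u s = mone;
  uhom_unitaryr : forall s, u s ** star (u s) = mone;
  uhom_strictL : forall b, continuous (fun s => mulL (u s) b);
  uhom_strictR : forall b, continuous (fun s => mulR (u s) b)
}.

(* A degenerate covariant homomorphism (pi need not be nondegenerate). *)
Record covariant_hom (A B : cstarAlgType R) (alpha : G -> A -> A)
    (pi : A -> multiplier B) (u : G -> multiplier B) : Prop := {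
  cov_pi : star_hom pi;
  cov_u : strict_unitary_hom u;
  covariance : forall s a, pi (alpha s a) = u s ** pi a ** star (u s)
}.

Definition Cc (f : G -> R[i]) : Prop :=
  continuous (f : G -> R[i]^o) /\
  exists K : set G, compact K /\ forall s, ~ K s -> f s = 0.

(* A left Haar measure, given as its integral on C_c(G). *)
Record is_haar (I : (G -> R[i]) -> R[i]) : Prop := {
  haar_linear : forall c f g, Cc f -> Cc g ->
    I (fun s => c * f s + g s) = c * I f + I g;
  haar_ge0 : forall f, Cc f -> (forall s, 0 <= f s) -> 0 <= I f;
  haar_invariant : forall f r, Cc f -> I (fun s => f (r * s)%g) = I f;
  haar_neq0 : exists2 f, Cc f & I f != 0
}.

Definition is_modular (I : (G -> R[i]) -> R[i]) (Delta : G -> R[i]) : Prop :=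
  forall r, 0 < Delta r /\
    forall f, Cc f -> Delta r * I (fun s => f (s * r)%g) = I f.

Definition convolution (I : (G -> R[i]) -> R[i]) (f g : G -> R[i]) :
    G -> R[i] :=
  fun s => I (fun r => f r * g (r^-1 * s)%g).

Definition cc_star (Delta : G -> R[i]) (f : G -> R[i]) : G -> R[i] :=
  fun s => Delta (s^-1)%g * conjc (f (s^-1)%g).

(* T is the strict integral of f(s) u_s, i.e. T b is for every b the (weakly
   characterized) vector-valued integral of f(s) u_s b. *)
Definition is_strict_integral (I : (G -> R[i]) -> R[i]) (B : cstarAlgType R)
    (u : G -> multiplier B) (f : G -> R[i]) (T : multiplier B) : Prop :=
  forall (b : B) (phi : {linear B -> R[i]^o}), continuous phi ->
    phi (mulL T b) = I (fun s => f s * phi (mulL (u s) b)).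

End GroupDefs.

(* C*(G): the completion of the convolution *-algebra C_c(G) for the norm
   sup_u || int f(s) u_s ds ||, where u ranges over the strictly continuous
   unitary homomorphisms into multiplier algebras.  The two universal norm
   fields say that `|gc_of f| is this supremum.  (gc_of is only meaningful on
   C_c(G).) *)
Record groupCStar (R : realType) (G : lcGroupType) := GroupCStar {
  gc_haar : (G -> R[i]) -> R[i];
  gc_modular : G -> R[i];
  gc_alg : cstarAlgType R;
  gc_of : (G -> R[i]) -> gc_alg;
  gc_haarP : is_haar gc_haar;
  gc_modularP : is_modular gc_haar gc_modular;
  gc_ofL : forall c f g, Cc f -> Cc g ->
    gc_of (fun s => c * f s + g s) = c *: gc_of f + gc_of g;
  gc_ofM : forall f g, Cc f -> Cc g ->
    gc_of (convolution gc_haar f g) = gc_of f ** gc_of g;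
  gc_ofS : forall f, Cc f -> gc_of (cc_star gc_modular f) = star (gc_of f);
  gc_dense : closure [set gc_of f | f in @Cc R G] = [set: gc_alg];
  gc_norm_ge : forall (B : cstarAlgType R) (u : G -> multiplier B) f T,
    Cc f -> strict_unitary_hom u -> is_strict_integral gc_haar u f T ->
    forall b, `|mulL T b| <= `|gc_of f| * `|b|;
  gc_norm_le : forall f (k : R[i]), Cc f -> 0 <= k ->
    (forall (B : cstarAlgType R) (u : G -> multiplier B) T,
       strict_unitary_hom u -> is_strict_integral gc_haar u f T ->
       forall b, `|mulL T b| <= k * `|b|) ->
    `|gc_of f| <= k
}.

(* uC : C*(G) -> M(B) is the homomorphism associated with u : G -> M(B),
   u(f) = int f(s) u_s ds for f in C_c(G).  By density of C_c(G) it is unique,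
   and it is automatically nondegenerate. *)
Definition integrated_form (R : realType) (G : lcGroupType)
    (CG : groupCStar R G) (B : cstarAlgType R) (u : G -> multiplier B)
    (uC : gc_alg CG -> multiplier B) : Prop :=
  star_hom uC /\
  forall f, Cc f -> is_strict_integral (gc_haar CG) u f (uC (gc_of CG f)).

(* (X, iA, iG) is a full crossed product of (A, alpha); iGC is the integrated
   form of iG. *)
Record is_crossed_product (R : realType) (G : lcGroupType)
    (CG : groupCStar R G) (A : cstarAlgType R) (alpha : G -> A -> A)
    (X : cstarAlgType R) (iA : A -> multiplier X) (iG : G -> multiplier X)
    (iGC : gc_alg CG -> multiplier X) : Prop := {
  cp_covariant : covariant_hom alpha iA iG;
  cp_nondegenerate : nondegenerate iA;
  cp_integrated : integrated_form iG iGC;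
  cp_prod : forall a c, exists x, membed x = iA a ** iGC c;
  cp_span :
    closed_span [set x | exists a c, membed x = iA a ** iGC c] = [set: X];
  cp_universal : forall (B : cstarAlgType R) (pi : A -> multiplier B)
      (u : G -> multiplier B) (uC : gc_alg CG -> multiplier B),
    covariant_hom alpha pi u -> nondegenerate pi -> integrated_form u uC ->
    exists! Phi : X -> multiplier B, star_hom Phi /\
      forall a c x, membed x = iA a ** iGC c -> Phi x = pi a ** uC c
}.

(* Main.v *)
(* Let Y be the closed right ideal of B generated by pi(A)B, and W the
   C*-subalgebra of all b such that b and b^* are in Y.  The covariant pair
   restricts to multipliers of W, and is nondegenerate there because A is the
   closed span of its products.  The universal property gives Phi0 : X -> M(W).
   An element T of the span of pi(A) uC(C*(G)) maps B into Y, as does T^*, and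
   acts on W as Phi0(x) for the corresponding x in X; computing |T z|^2 with
   z z^* in W for z in Y, one gets |T| <= |x|.  Hence x |-> T is well defined
   and extends to X by continuity.

   Homomorphisms are contractive
   because a selfadjoint h with |h| < 1 is the real part of the unitary
   h + i (1 - h^2)^(1/2).  A is the closed span of A A because moreover
   |h - h^3| <= 1/2.  Integrals being characterized by functionals, the
   invariance of Y and W under uC, and the integrated form of the restricted
   representation of G, come from the Hahn-Banach theorem. *)

Require Import Defs.
From HB Require Import structures.
From mathcomp Require Import all_boot all_order all_algebra.
From mathcomp Require Import all_classical all_reals all_analysis.
From mathcomp.real_closed Require Import complex.
Set Implicit Arguments.
Unset Strict Implicit.
Unset Printing Implicit Defensive.
Import Order.TTheory GRing.Theory Num.Theory.
Import numFieldNormedType.Exports.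
Local Open Scope classical_set_scope.
Local Open Scope ring_scope.

(** * Closed subspaces *)

Lemma sqr_le_mul (F : numDomainType) (s t : F) :
  0 <= s -> 0 <= t -> t ^+ 2 <= s * t -> t <= s.
Proof.
move=> s0; rewrite le_eqVlt => /orP[/eqP <- //|t0].
by rewrite expr2 ler_pM2r.
Qed.

Lemma le0_eps (F : numFieldType) (t : F) :
  0 <= t -> (forall e, 0 < e -> t <= e) -> t = 0.
Proof.
move=> t0 h; apply/eqP/negPn/negP => tn0.
have tp : 0 < t by rewrite lt_def tn0.
have := h (t / 2) (divr_gt0 tp (ltr0n _ 2)).
rewrite -[X in X <= _]mulr1 ler_pM2l// => h1.
have : (1 : F) < 1.
  by apply: le_lt_trans h1 _; rewrite invf_lt1 ?ltr1n ?ltr0n.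
by rewrite ltxx.
Qed.

(** Half the harmonic mean lies below both numbers, which avoids comparing [a] with [b]. *)
Lemma pos_lower_bound (F : numFieldType) (a b : F) :
  0 < a -> 0 < b -> exists m, [/\ 0 < m, m <= a & m <= b].
Proof.
move=> a0 b0; exists (a * b / (a + b)).
have ab0 : 0 < a + b by rewrite addr_gt0.
split; first by rewrite divr_gt0// mulr_gt0.
  by rewrite ler_pdivrMr// ler_pM2l// lerDr ltW.
by rewrite ler_pdivrMr// [leLHS]mulrC ler_pM2l// lerDl ltW.
Qed.

Section ClosedSubspaces.
Context {K : numFieldType}.

Lemma closure_normP (V : normedModType K) (S : set V) x :
  closure S x <-> forall e, 0 < e -> exists2 y, S y & `|x - y| <= e.
Proof.
split=> [cS e e0|h U /nbhs_ballP[e /= e0 eU]].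
  have /cS[y [Sy]] : nbhs x (ball x e) by exact: nbhsx_ballx.
  by rewrite -ball_normE /= => /ltW; exists y.
have [|y Sy xy] := h (e / 2); first by rewrite divr_gt0.
exists y; split => //; apply: eU; rewrite -ball_normE /=.
apply: le_lt_trans xy _; rewrite -[ltRHS]mulr1 ltr_pM2l//.
by rewrite invf_lt1 ?ltr1n ?ltr0n.
Qed.

(** Closedness is phrased by approximation within every [e], the form in which norm estimates
    deliver it. *)
Record csub (V : normedModType K) (W : set V) : Prop := {
  csub0 : W 0;
  csubZD : forall c x y, W x -> W y -> W (c *: x + y);
  csub_cl : forall x, (forall e, 0 < e -> exists2 y, W y & `|x - y| <= e) -> W x
}.

Lemma csubD (V : normedModType K) (W : set V) x y :
  csub W -> W x -> W y -> W (x + y).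
Proof. by move=> cW Wx Wy; rewrite -[x]scale1r; exact: csubZD. Qed.

Lemma csubZ (V : normedModType K) (W : set V) c x : csub W -> W x -> W (c *: x).
Proof. by move=> cW Wx; rewrite -[_ *: _]addr0; apply: csubZD => //; case: cW. Qed.

Lemma csub_sum (V : normedModType K) (W : set V) n (f : 'I_n -> V) :
  csub W -> (forall i, W (f i)) -> W (\sum_(i < n) f i).
Proof.
by move=> cW Wf; apply: big_ind => [|x y Wx Wy|//]; [case: cW|exact: csubD].
Qed.

Lemma csubI (V : normedModType K) (W W' : set V) :
  csub W -> csub W' -> csub (W `&` W').
Proof.
move=> cW cW'; split; first by split; [case: cW|case: cW'].
  by move=> c x y [? ?] [? ?]; split; exact: csubZD.
move=> x h; split.
- by apply: (csub_cl cW) => e /h[y [? ?] ?]; exists y.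
- by apply: (csub_cl cW') => e /h[y [? ?] ?]; exists y.
Qed.

Lemma csub_set0 (V : normedModType K) : csub [set 0 : V].
Proof.
split=> //= [c x y -> ->|x h]; first by rewrite scaler0 addr0.
by apply/normr0_eq0/le0_eps => // e /h[_ ->]; rewrite subr0.
Qed.

(* The scalars are only required to be transformed somehow, so as to cover
   conjugate-linear maps. *)
Lemma csub_preim (V V' : normedModType K) (W : set V') (f : V -> V') s k :
  csub W -> {morph f : x y / x + y} -> (forall c x, f (c *: x) = s c *: f x) ->
  0 <= k -> (forall x, `|f x| <= k * `|x|) -> csub (f @^-1` W).
Proof.
move=> cW fD fZ k0 fk.
have f0 : f 0 = 0 by apply: (addrI (f 0)); rewrite -fD !addr0.
split=> /= [|c x y Wx Wy|x h].
- by rewrite f0; case: cW.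
- by rewrite fD fZ; apply: csubZD.
apply: (csub_cl cW) => e e0.
have k1 : 0 < k + 1 by rewrite ltr_wpDl.
have [|y Wy xy] := h (e / (k + 1)); first by rewrite divr_gt0.
exists (f y) => //.
have -> : f x - f y = f (x - y) by apply/eqP; rewrite subr_eq -fD subrK.
apply: le_trans (fk _) _; move: xy; rewrite ler_pdivlMr// mulrC => xy.
by apply: le_trans xy; rewrite ler_wpM2r// lerDl.
Qed.

Lemma csub_closure (V : normedModType K) (S : set V) :
  S 0 -> (forall c x y, S x -> S y -> S (c *: x + y)) -> csub (closure S).
Proof.
move=> S0 SZD; split; first exact: subset_closure.
  move=> c x y /closure_normP Sx /closure_normP Sy; apply/closure_normP => e e0.
  have c1 : 0 < `|c| + 1 by rewrite ltr_wpDl.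
  have [|x' Sx' xx'] := Sx (e / 2 / (`|c| + 1)); first by rewrite !divr_gt0.
  have [|y' Sy' yy'] := Sy (e / 2); first by rewrite divr_gt0.
  exists (c *: x' + y'); first exact: SZD.
  rewrite opprD addrACA -scalerBr; apply: le_trans (ler_normD _ _) _.
  rewrite [leRHS](splitr e) lerD// normrZ.
  move: xx'; rewrite ler_pdivlMr// => xx'; apply: le_trans xx'.
  by rewrite mulrC ler_wpM2l// lerDl.
move=> x h; apply/closure_normP => e e0.
have e20 : 0 < e / 2 by rewrite divr_gt0.
have [y /closure_normP cy xy] := h _ e20; have [z Sz yz] := cy _ e20.
exists z => //; rewrite [leRHS](splitr e) -(subrK y x) -addrA.
by apply: le_trans (ler_normD _ _) _; rewrite lerD.
Qed.
End ClosedSubspaces.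

Section ClosedSpan.
Context {R : realType} {V : normedModType R[i]}.
Implicit Types (S W : set V).

Lemma sub_closed_span S : S `<=` closed_span S.
Proof.
move=> x Sx; apply: subset_closure => /=.
exists 1%N, (fun=> 1), (fun=> x); split => //.
by rewrite big_ord_recl big_ord0 addr0 scale1r.
Qed.

Lemma csub_closed_span S : csub (closed_span S).
Proof.
apply: csub_closure.
  by exists 0%N, (fun=> 0), (fun=> 0); split; [case|rewrite big_ord0].
move=> c _ _ [n [a [u [Su ->]]]] [m [b [v [Sv ->]]]].
exists (n + m)%N.
exists (fun i : 'I_(n + m) =>
  match fintype.split i with inl j => c * a j | inr j => b j end).
exists (fun i : 'I_(n + m) =>
  match fintype.split i with inl j => u j | inr j => v j end).
split=> [i|]; first by case: (fintype.split i).
rewrite big_split_ord /= scaler_sumr; congr (_ + _); apply: eq_bigr => i _.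
  by rewrite (unsplitK (inl i)) scalerA.
by rewrite (unsplitK (inr i)).
Qed.

(** This serves as the induction principle for closed spans: a property that defines a [csub] need
    only be checked on generators. *)
Lemma closed_span_sub S W : csub W -> S `<=` W -> closed_span S `<=` W.
Proof.
move=> cW SW x /closure_normP cx; apply: (csub_cl cW) => e /cx[y [n [c [u [Su ->]]]] h].
by eexists; [|exact: h]; apply: csub_sum => // i; apply: csubZ => //; exact: SW.
Qed.

End ClosedSpan.

(** * Limits in complete normed spaces *)

Section Complete.
Context {K : numFieldType} {V : completeNormedModType K}.

(* A criterion for the existence of limits where P e x reads: x is an
   approximation of the limit up to e. *)
Lemma complete_approx (P : K -> V -> Prop) :
  (forall e, 0 < e -> exists x, P e x) ->
  (forall e x d y, 0 < e -> 0 < d -> P e x -> P d y -> `|x - y| <= e + d) ->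
  exists l, forall e x, 0 < e -> P e x -> `|x - l| <= e.
Proof.
move=> Pex PP.
(* [P] carries no monotonicity in [e]; collecting all precisions [d <= e] makes the sets shrink with
   [e], hence a filter base. *)
pose B e := [set x | exists2 d, 0 < d <= e & P d x].
pose F := filter_from [set e : K | 0 < e] B.
have FF : ProperFilter F.
  apply: filter_from_proper; last first.
    by move=> e /= e0; have [x Px] := Pex _ e0; exists x, e; rewrite ?e0/=.
  apply: filter_from_filter; first by exists 1 => /=.
  move=> e d /= e0 d0; have [m [m0 me md]] := pos_lower_bound e0 d0.
  exists m => // x [c /andP[c0 cm] Pcx].
  by split; exists c => //; rewrite c0 (le_trans cm).
have : cvg F.
  apply: cauchy_cvg; apply/cauchy_ballP => e e0.
  have e20 : 0 < e / 2 by rewrite divr_gt0.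
  have e40 : 0 < e / 2 / 2 by rewrite divr_gt0.
  exists (B (e / 2 / 2), B (e / 2 / 2)); first by split; exists (e / 2 / 2).
  move=> [x y] [[c /andP[c0 ce] Px] [d /andP[d0 de] Py]] /=.
  rewrite -ball_normE /=; apply: le_lt_trans (PP _ _ _ _ c0 d0 Px Py) _.
  apply: le_lt_trans (lerD ce de) _; rewrite -splitr.
  by rewrite -[ltRHS]mulr1 ltr_pM2l// invf_lt1 ?ltr1n ?ltr0n.
move=> /cvg_ex[l /fcvg_ballP Fl]; exists l => e x e0 Px.
apply/ler_addgt0Pr => d d0.
have d20 : 0 < d / 2 by rewrite divr_gt0.
have [c /= c0 cB] := Fl _ d20.
have [m [m0 mc md]] := pos_lower_bound c0 d20.
have [y Py] := Pex _ m0.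
have /cB : B c y by exists m => //; rewrite m0.
rewrite -ball_normE /= distrC => /ltW yl.
rewrite -(subrK y x) -addrA [d]splitr [leRHS]addrA.
apply: le_trans (ler_normD _ _) _; rewrite lerD//.
by apply: le_trans (PP _ _ _ _ e0 m0 Px Py) _; rewrite lerD2l.
Qed.
End Complete.

(** * Norm and unitaries in multiplier algebras *)

Section StarAlgebras.
Context {R : realType} {A : starAlgType R}.
Implicit Types x y : A.

Lemma star_mulNl x y : (- x) ** y = - (x ** y).
Proof. by rewrite -scaleN1r amulZl scaleN1r. Qed.

Lemma star_mulNr x y : x ** (- y) = - (x ** y).
Proof. by rewrite -scaleN1r amulZr scaleN1r. Qed.

Lemma starN x : star (- x) = - star x.
Proof. by rewrite -scaleN1r starZ rmorphN rmorph1 scaleN1r. Qed.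

Lemma star0 : star (0 : A) = 0.
Proof. by rewrite -(scale0r 0) starZ conjc0 !scale0r. Qed.

Lemma starB x y : star (x - y) = star x - star y.
Proof. by rewrite starD starN. Qed.

End StarAlgebras.

Section StarHom.
Context {R : realType} {A B : starAlgType R} {f : A -> B} (hf : star_hom f).

Lemma star_homD x y : f (x + y) = f x + f y.
Proof. by have := star_hom_linear hf 1 x y; rewrite !scale1r. Qed.

Lemma star_hom0 : f 0 = 0.
Proof. by apply: (addrI (f 0)); rewrite -star_homD !addr0. Qed.

Lemma star_homZ c x : f (c *: x) = c *: f x.
Proof. by have := star_hom_linear hf c x 0; rewrite star_hom0 !addr0. Qed.

Lemma star_homN x : f (- x) = - f x.
Proof. by rewrite -scaleN1r star_homZ scaleN1r. Qed.

End StarHom.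

Section CStarNorm.
Context {R : realType} {B : cstarAlgType R}.
Implicit Types (a b x : B) (S T U : multiplier B).

(** The C*-identity gives [|y|^2 <= |star y| |y|], hence one inequality; applying it to [star x]
    gives the other. *)
Lemma norm_star x : `|star x| = `|x|.
Proof.
have le y : `|y| <= `|star y|.
  by apply: sqr_le_mul => //; rewrite -normA_star normAM_le.
by apply/eqP; rewrite eq_le le -{2}[x]starK le.
Qed.

Lemma normA_starr x : `|x ** star x| = `|x| ^+ 2.
Proof. by rewrite -{1}[x]starK normA_star norm_star. Qed.

(** The relation [a ** mulL T b = mulR T a ** b] determines [mulR T] from [mulL T], because elements
    of [B] are separated by multiplication. *)
Lemma multiplier_extL S T : mulL S =1 mulL T -> S = T.
Proof.
move=> h; apply: multiplier_ext => // a; apply: amulIr => b.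
by rewrite -!multiplierP h.
Qed.

Lemma mulL_add S T b : mulL (S + T) b = mulL S b + mulL T b.
Proof. by []. Qed.

Lemma mulL_opp S b : mulL (- S) b = - mulL S b.
Proof. by []. Qed.

Lemma mulL_scale c S b : mulL (c *: S) b = c *: mulL S b.
Proof. by []. Qed.

Lemma mulL_mul S T b : mulL (S ** T) b = mulL S (mulL T b).
Proof. by []. Qed.

Lemma mulR_star T b : mulR (star T) b = star (mulL T (star b)).
Proof. by []. Qed.

Lemma mulL_star T b : mulL (star T) b = star (mulR T (star b)).
Proof. by []. Qed.

Lemma mul1m T : mone ** T = T.
Proof. exact: multiplier_ext. Qed.

Lemma mulm1 T : T ** mone = T.
Proof. exact: multiplier_ext. Qed.

Lemma star_mone : star mone = mone :> multiplier B.
Proof. by apply: multiplier_ext => b /=; rewrite starK. Qed.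

Lemma mulLM T a b : mulL T (a ** b) = mulL T a ** b.
Proof. by apply: amulIl => c; rewrite multiplierP !amulA multiplierP. Qed.

(** Left actions are right [B]-linear, so they commute with right actions. Consequently the span of
    [pi(A) B] is preserved by right actions. *)
Lemma mulLR S T b : mulR T (mulL S b) = mulL S (mulR T b).
Proof.
by apply: amulIr => c; rewrite -multiplierP -!mulLM -multiplierP.
Qed.


(** This is the adjoint relation for the [B]-valued inner product [star a ** b]. *)
Lemma star_mulL_mul S T a b :
  star (mulL S a) ** mulL T b = star a ** mulL (star S ** T) b.
Proof. by rewrite mulL_mul [RHS]multiplierP mulR_star starK. Qed.

Lemma membed_star_hom : star_hom (@membed R B).
Proof.
split=> [c x y|x y|x]; apply: multiplier_extL => b /=.
- by rewrite amulDl amulZl.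
- by rewrite amulA.
- by rewrite starM !starK.
Qed.

Lemma mulL_norm_le T (k : R[i]) b : 0 <= k ->
  (`|mulL (star T ** T) b| <= k ^+ 2 * `|b|) -> `|mulL T b| <= k * `|b|.
Proof.
move=> k0 h; rewrite -(ler_pXn2r (ltn0Sn 1))// ?nnegrE ?mulr_ge0//.
rewrite -normA_star star_mulL_mul; apply: le_trans (normAM_le _ _) _.
rewrite norm_star; apply: le_trans (ler_wpM2l (normr_ge0 b) h) _.
by rewrite mulrCA -expr2 exprMn.
Qed.

Lemma unitary_norm T b : star T ** T = mone -> `|mulL T b| = `|b|.
Proof.
move=> TT; apply/eqP; rewrite -(eqrXn2 (ltn0Sn 1))//.
by rewrite -!normA_star star_mulL_mul TT.
Qed.

(** With [t = |mulL (star T) b|], the C*-identity gives [t^2 <= |b| * k * t], and one factor [t]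
    cancels. *)
Lemma mulL_star_le T (k : R[i]) : 0 <= k ->
  (forall b, `|mulL T b| <= k * `|b|) -> forall b, `|mulL (star T) b| <= k * `|b|.
Proof.
move=> k0 h b; apply: sqr_le_mul; rewrite ?mulr_ge0//.
rewrite -normA_star star_mulL_mul starK; apply: le_trans (normAM_le _ _) _.
rewrite norm_star mulL_mul.
apply: le_trans (ler_wpM2l (normr_ge0 b) (h _)) _.
by rewrite mulrCA mulrA.
Qed.

Lemma mulR_le T (k : R[i]) : 0 <= k ->
  (forall b, `|mulL T b| <= k * `|b|) -> forall b, `|mulR T b| <= k * `|b|.
Proof.
move=> k0 h b.
by rewrite -[T]starK mulR_star norm_star -[`|b|]norm_star mulL_star_le.
Qed.

End CStarNorm.

Section RealPart.
Context {R : realType} {B : cstarAlgType R}.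
Implicit Types H C V W : multiplier B.

Lemma conjc_i : conjc ('i%C : R[i]) = - 'i%C.
Proof. by apply/eqP; rewrite eq_complex /= oppr0 !eqxx. Qed.

(* If H = cos and C = sin, then V and W are the exponentials. *)
Lemma real_part_unitary H C :
  star H = H -> star C = C -> H ** C = C ** H -> H ** H + C ** C = mone ->
  exists V W, [/\ V ** W = mone, W ** V = mone, V + W = 2 *: H,
    forall b, `|mulL V b| = `|b| & forall b, `|mulL W b| = `|b|].
Proof.
move=> Hs Cs HC H2C2; pose V := H + 'i%C *: C; pose W := H - 'i%C *: C.
have starV : star V = W by rewrite /V starD starZ Hs Cs conjc_i scaleNr.
have starW : star W = V by rewrite -starV starK.
have ii : 'i%C * 'i%C = -1 :> R[i] by rewrite -expr2 sqr_i.
have VW : V ** W = mone.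
  rewrite /V /W !amulDl !amulDr !star_mulNr !amulZl !amulZr HC scalerA ii.
  by rewrite scaleN1r opprK addrA subrK.
have WV : W ** V = mone.
  rewrite /V /W !amulDl !amulDr !star_mulNl !amulZl !amulZr HC scalerA ii.
  by rewrite scaleN1r opprK addrA addrK.
exists V, W; split => // [|b|b].
- by rewrite /V /W addrACA subrr addr0 scaler_nat mulr2n.
- by apply: unitary_norm; rewrite starV.
- by apply: unitary_norm; rewrite starW.
Qed.

(** [H] is the mean of the two isometries [V] and [W]. *)
Lemma cos_le1 H C b :
  star H = H -> star C = C -> H ** C = C ** H -> H ** H + C ** C = mone ->
  `|mulL H b| <= `|b|.
Proof.
move=> Hs Cs HC H2C2.
have [V [W [_ _ HE Vn Wn]]] := real_part_unitary Hs Cs HC H2C2.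
rewrite -(ler_pM2l (ltr0n R[i] 2)) -[X in X * `|mulL H b|]ger0_norm//.
rewrite -normrZ -mulL_scale -HE mulL_add.
by rewrite (le_trans (ler_normD _ _))// Vn Wn mulr_natl mulr2n.
Qed.

(** In the expansion of the cube of [V + W], the mixed products collapse to three copies each of [V]
    and [W], since [V] and [W] are inverse to each other. This is the triple-angle formula. *)
Lemma cos_cube H V W :
  V ** W = mone -> W ** V = mone -> V + W = 2 *: H ->
  H ** H ** H =
  8^-1 *: (V ** V ** V + W ** W ** W + (V + W) *+ 3).
Proof.
move=> VW WV HE.
have -> : H = 2^-1 *: (V + W).
  by rewrite HE scalerA mulVf ?scale1r// pnatr_eq0.
rewrite !(amulZl, amulZr) !scalerA.
have -> : 2^-1 / 2 / 2 = 8^-1 :> R[i] by rewrite -!invfM -!natrM.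
congr (_ *: _).
have -> : (V + W) ** (V + W) = V ** V + W ** W + (mone + mone).
  rewrite amulDl !amulDr VW WV.
  by rewrite (addrC mone (W ** W)) addrACA.
rewrite !amulDl !mul1m !amulDr -(amulA V V W) VW mulm1.
rewrite -(amulA W W V) WV mulm1.
rewrite (addrC W) (addrACA _ V).
rewrite -[LHS]addrA; congr (_ + _).
Qed.

(* 8 (cos - cos^3) = e + e^-1 - e^3 - e^-3 *)
Lemma cos_sub_cube_le H C b :
  star H = H -> star C = C -> H ** C = C ** H -> H ** H + C ** C = mone ->
  `|mulL (H - H ** H ** H) b| <= `|b| / 2.
Proof.
move=> Hs Cs HC H2C2.
have [V [W [VW WV HE Vn Wn]]] := real_part_unitary Hs Cs HC H2C2.
have -> : H - H ** H ** H = 8^-1 *: (V + W - V ** V ** V - W ** W ** W).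
  rewrite (cos_cube VW WV HE).
  have {1}-> : H = 8^-1 *: ((V + W) *+ 4).
    rewrite HE -[(2 *: H) *+ 4]scaler_nat !scalerA (_ : _ * _ = 1) ?scale1r//.
    by rewrite -?mulrA -natrM mulVf// pnatr_eq0.
  rewrite -scalerBr; congr (_ *: _).
  by rewrite mulrS opprD addrACA subrr addr0 opprD addrA.
rewrite mulL_scale normrZ gtr0_norm ?invr_gt0//.
rewrite mulrC ler_pdivrMr// -mulrA (_ : 2^-1 * 8 = 4)%R; last first.
  by rewrite (natrM _ 2 4) mulKf ?pnatr_eq0.
rewrite (_ : _ * 4 = `|b| + `|b| + `|b| + `|b|); last first.
  by rewrite mulr_natr !mulrS mulr0n addr0 !addrA.
have V3 : `|mulL (V ** V ** V) b| = `|b| by rewrite !mulL_mul !Vn.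
have W3 : `|mulL (W ** W ** W) b| = `|b| by rewrite !mulL_mul !Wn.
rewrite -{3}V3 -{3}W3 -{1}(Vn b) -(Wn b) !mulL_add !mulL_opp.
rewrite (le_trans (ler_normB _ _))// lerD2r.
by rewrite (le_trans (ler_normB _ _))// lerD2r ler_normD.
Qed.
End RealPart.

(** * Square roots, contractivity and products *)

Section FixedPoint.
Context {R : realType} {V : completeNormedModType R[i]}.

Lemma expC_small (q e : R[i]) : 0 <= q < 1 -> 0 < e -> exists n, q ^+ n <= e.
Proof.
move=> /andP[q0 q1] e0.
have /complex_realP[r qr] : q \is Num.real by exact: ger0_real.
have /complex_realP[d ed] : e \is Num.real by exact: gtr0_real.
move: q0 q1 e0; rewrite {}qr {}ed ler0c ltcR ltcR => r0 r1 d0.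
have : `|r| < 1 by rewrite ger0_norm.
move=> /cvg_expr/cvgrPdist_lt/(_ d d0)[N _ /(_ N (leqnn N))] /=.
rewrite sub0r normrN ger0_norm ?exprn_ge0// => rN.
by exists N; rewrite -rmorphXn lecR ltW.
Qed.

Lemma contraction_fixed_point (U : set V) (f : V -> V) (q : R[i]) x0 :
  (forall x, (forall e, 0 < e -> exists2 y, U y & `|x - y| <= e) -> U x) ->
  (forall x, U x -> U (f x)) -> 0 <= q < 1 ->
  (forall x y, U x -> U y -> `|f x - f y| <= q * `|x - y|) ->
  U x0 -> exists2 x, U x & f x = x.
Proof.
move=> Ucl Uf q01 fq Ux0; have /andP[q0 q1] := q01.
have q1' : 0 < 1 - q by rewrite subr_gt0.
have Uit n : U (iter n f x0) by elim: n => //= n; exact: Uf.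
have fit n : `|f (iter n f x0) - iter n f x0| <= q ^+ n * `|f x0 - x0|.
  elim: n => [|n IHn]; first by rewrite expr0 mul1r.
  rewrite exprS -mulrA; apply: le_trans (fq _ _ (Uit n.+1) (Uit n)) _.
  by rewrite ler_wpM2l.
(* The inequality [(1 - q) |x - y| <= |f x - x| + |f y - y|] shows that points moved by at most
   [(1 - q) * e] and [(1 - q) * d] are within [e + d] of each other. *)
pose P e x := U x /\ `|f x - x| <= (1 - q) * e.
have Pex e : 0 < e -> exists x, P e x.
  move=> e0; have c0 : 0 < `|f x0 - x0| + 1 by rewrite ltr_wpDl.
  have [|n nq] := @expC_small q ((1 - q) * e / (`|f x0 - x0| + 1)) q01.
    by rewrite divr_gt0 ?mulr_gt0.
  exists (iter n f x0); split => //; apply: le_trans (fit n) _.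
  move: nq; rewrite ler_pdivlMr// => nq; apply: le_trans nq.
  by rewrite ler_wpM2l ?exprn_ge0// lerDl.
have PP e x d y : 0 < e -> 0 < d -> P e x -> P d y -> `|x - y| <= e + d.
  move=> e0 d0 [Ux ex] [Uy dy]; rewrite -(ler_pM2l q1').
  rewrite mulrBl mul1r lerBlDr mulrDr.
  have {1}-> : x - y = (x - f x) + (f y - y) + (f x - f y).
    by rewrite -addrA [f y - y + _]addrC !subrKA.
  apply: le_trans (ler_normD _ _) _; rewrite lerD ?fq//.
  by apply: le_trans (ler_normD _ _) _; rewrite distrC lerD.
have [l Pl] := complete_approx Pex PP.
have Ul : U l.
  apply: Ucl => e e0; have [x Px] := Pex _ e0.
  by exists x; [case: Px|rewrite distrC; exact: Pl Px].
exists l => //; apply/eqP; rewrite -subr_eq0 -normr_eq0; apply/eqP/le0_eps => // e e0.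
have e30 : 0 < e / 3 by rewrite divr_gt0.
have [x Px] := Pex _ e30.
have -> : f l - l = (f l - f x) + (f x - x) + (x - l) by rewrite !addrA !subrK.
have -> : e = e / 3 + e / 3 + e / 3.
  by rewrite -!mulrDl -mulr2n -mulrSr -[e *+ _]mulr_natr mulfK ?pnatr_eq0.
have lx := Pl _ _ e30 Px; case: Px => Ux xx.
apply: le_trans (ler_normD _ _) _; rewrite lerD//.
apply: le_trans (ler_normD _ _) _; rewrite lerD//.
  apply: le_trans (fq _ _ Ul Ux) _; rewrite distrC.
  by rewrite -[leRHS]mul1r ler_pM// ltW.
apply: le_trans xx _; rewrite -[leRHS]mul1r ler_wpM2r ?(ltW e30)//.
by rewrite gerBl.
Qed.

End FixedPoint.

Section SquareRoot.
Context {R : realType} {A : cstarAlgType R}.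
Implicit Types h k : A.

(* 1 - k is the square root of 1 - h^2; k is the fixed point of
   k |-> (h^2 + k^2) / 2 on the ball of radius |h|. *)
Lemma sqrt_one_sub_sqr h : star h = h -> `|h| < 1 ->
  exists k, [/\ star k = k, h ** k = k ** h & k + k = h ** h + k ** k].
Proof.
move=> hs h1.
(* Selfadjointness and commutation with [h] are built into [U], so the fixed point inherits them. On
   this ball [f] is Lipschitz with constant [|h|], as [x^2 - y^2 = x (x - y) + (x - y) y]. *)
pose U := [set k | [/\ star k = k, h ** k = k ** h & `|k| <= `|h|] ].
pose f k := 2^-1 *: (h ** h + k ** k).
have h20 : 0 < 2^-1 :> R[i] by rewrite invr_gt0.
have n2 : `|2^-1 : R[i]| = 2^-1 by rewrite ger0_norm// ltW.
have [|||||k [ks hk _] fk] := @contraction_fixed_point R A U f `|h| 0.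
- move=> x Ux; split.
  + apply/eqP; rewrite -subr_eq0 -normr_eq0; apply/eqP/le0_eps => // e e0.
    have [|y [ys _ _] xy] := Ux (e / 2); first by rewrite divr_gt0.
    rewrite -[star x](subrK (star y)) -addrA ys [leRHS]splitr.
    apply: le_trans (ler_normD _ _) _; rewrite lerD//; last by rewrite distrC.
    by rewrite -{1}ys -starB norm_star.
  + apply/eqP; rewrite -subr_eq0 -normr_eq0; apply/eqP/le0_eps => // e e0.
    have [|y [_ yh _] xy] := Ux (e / 2); first by rewrite divr_gt0.
    have -> : h ** x - x ** h = h ** (x - y) - (x - y) ** h.
      rewrite amulDr amulDl star_mulNr star_mulNl yh opprB.
      by rewrite subrKA.
    rewrite [leRHS]splitr.
    apply: le_trans (ler_normB _ _) _; rewrite lerD//.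
      apply: le_trans (normAM_le _ _) _; apply: le_trans xy.
      by rewrite ler_piMl// ltW.
    apply: le_trans (normAM_le _ _) _; apply: le_trans xy.
    by rewrite ler_piMr// ltW.
  + apply/ler_addgt0Pr => e /Ux[y [_ _ yh] xy].
    by rewrite -(subrK y x) addrC; apply: le_trans (ler_normD _ _) _; exact: lerD.
- move=> k [ks hk kh]; split.
  + by rewrite /f starZ starD !starM hs ks rmorphV ?unitfE// rmorph_nat.
  + rewrite /f amulZr amulZl; congr (_ *: _).
    by rewrite amulDr amulDl !amulA hk -!amulA hk.
  + rewrite /f normrZ n2 ler_pdivrMl//.
    apply: le_trans (ler_normD _ _) _; rewrite mulr_natl mulr2n lerD//.
      by apply: le_trans (normAM_le _ _) _; rewrite ler_piMl// ltW.
    apply: le_trans (normAM_le _ _) _; rewrite (le_trans _ kh)//.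
    by rewrite ler_piMl// (le_trans kh)// ltW.
- by rewrite normr_ge0.
- move=> x y [_ _ xh] [_ _ yh]; rewrite /f -scalerBr normrZ n2 ler_pdivrMl//.
  have -> : h ** h + x ** x - (h ** h + y ** y) = x ** (x - y) + (x - y) ** y.
    rewrite addrC opprD addrACA addNr add0r amulDr amulDl star_mulNr star_mulNl.
    by rewrite addrA subrK addrC.
  apply: le_trans (ler_normD _ _) _.
  rewrite mulr_natl mulr2n lerD// (le_trans (normAM_le _ _))//.
    by rewrite ler_wpM2r.
  by rewrite mulrC ler_wpM2r.
- by split; rewrite ?star0 ?normr0// amul0l -(scale0r (0 : A)) amulZr !scale0r.
exists k; split => //; rewrite -{1 2}fk /f -scalerDl.
by rewrite -mulr2n -[_ *+ 2]mulr_natr mulVf ?scale1r// pnatr_eq0.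
Qed.

End SquareRoot.

Lemma conjc_ge0 (R : realType) (t : R[i]) : 0 <= t -> conjc t = t.
Proof. by move=> /ger0_real/complex_realP[r ->]; rewrite conjc_real. Qed.

Section Contractive.
Context {R : realType} {A B : cstarAlgType R} {phi : A -> multiplier B}.
Hypothesis hphi : star_hom phi.

(** [A] need not have a unit, so the sine [C = mone - phi k] is formed in the multiplier algebra.
    The equation [k + k = h^2 + k^2] says exactly that [(1 - k)^2 = 1 - h^2]. *)
Lemma sqrt_one_sub_sqr_hom h : star h = h -> `|h| < 1 ->
  exists C, [/\ star (phi h) = phi h, star C = C,
    phi h ** C = C ** phi h & phi h ** phi h + C ** C = mone].
Proof.
move=> hs h1; have [k [ks hk kk]] := sqrt_one_sub_sqr hs h1.
exists (mone - phi k); split.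
- by rewrite -(star_homS hphi) hs.
- by rewrite starB star_mone -(star_homS hphi) ks.
- rewrite amulDr amulDl star_mulNr star_mulNl mulm1 mul1m.
  by rewrite -!(star_homM hphi) hk.
- rewrite amulDr mulm1 star_mulNr amulDl star_mulNl mul1m opprB.
  rewrite -!(star_homM hphi).
  have : phi k + phi k = phi (h ** h) + phi (k ** k).
    by rewrite -!(star_homD hphi) kk.
  move=> /(canLR (addrK _)) <-.
  by rewrite [mone - _ + _]addrC addrA subrKA addrK addrC subrK.
Qed.

(** For [t > |h|] the element [h / t] has norm below 1, so its image is a cosine and has norm at
    most 1; then [t] decreases to [|h|]. *)
Lemma star_hom_sa_le h b : star h = h -> `|mulL (phi h) b| <= `|h| * `|b|.
Proof.
move=> hs.
suff le t : `|h| < t -> `|mulL (phi h) b| <= t * `|b|.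
  apply/ler_addgt0Pr => e e0.
  have c0 : 0 < `|b| + 1 by rewrite ltr_wpDl.
  apply: le_trans (le (`|h| + e / (`|b| + 1)) _) _; first by rewrite ltrDl divr_gt0.
  rewrite mulrDl lerD2l mulrAC ler_pdivrMr// ler_wpM2l ?(ltW e0)//.
  by rewrite lerDl.
move=> ht; have t0 : 0 < t by apply: le_lt_trans ht.
have [||C [Hs Cs HC H2]] := @sqrt_one_sub_sqr_hom (t^-1 *: h).
- rewrite starZ hs; congr (_ *: _).
  by rewrite conjc_ge0// invr_ge0 ltW.
- by rewrite normrZ gtr0_norm ?invr_gt0// ltr_pdivrMl// mulr1.
have := cos_le1 b Hs Cs HC H2.
rewrite (star_homZ hphi) mulL_scale normrZ gtr0_norm ?invr_gt0//.
by rewrite ler_pdivrMl.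
Qed.

(** The C*-identity reduces the bound to the selfadjoint element [star a ** a]. *)
Lemma star_hom_le a b : `|mulL (phi a) b| <= `|a| * `|b|.
Proof.
apply: mulL_norm_le => //; rewrite -(star_homS hphi) -(star_homM hphi).
rewrite -normA_star; apply: star_hom_sa_le.
by rewrite starM starK.
Qed.

End Contractive.

Section Idempotent.
Context {R : realType} {A : cstarAlgType R}.
Implicit Types a h : A.

Lemma sub_cube_le h : star h = h -> `|h| < 1 -> `|h - h ** h ** h| <= 2^-1.
Proof.
move=> hs h1.
have [C [Hs Cs HC H2]] := sqrt_one_sub_sqr_hom (membed_star_hom (B := A)) hs h1.
set z := h - _; apply: sqr_le_mul; rewrite ?invr_ge0//.
(* Under the embedding [membed] into the multipliers, evaluation at [star z] produces
   [|z ** star z| = |z|^2], from which one factor [|z|] cancels. *)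
have := cos_sub_cube_le (star z) Hs Cs HC H2.
have mD := star_homD (membed_star_hom (B := A)).
have mN := star_homN (membed_star_hom (B := A)).
have mM := star_homM (membed_star_hom (B := A)).
rewrite -!mM -mN -mD -/z /= normA_starr norm_star => /le_trans -> //.
by rewrite mulrC.
Qed.

Let D : set A := closed_span [set x | exists a b, x = a ** b].

Let DM a b : D (a ** b).
Proof. by apply: sub_closed_span; exists a, b. Qed.

(** With [t = 3/2 * M] and [g = h / t] one has [|g| < 1]. The cube of [g] is a product, and the
    remainder [t (g - g^3)] is selfadjoint of norm at most [t / 2 = 3/4 * M], so the argument
    repeats on it. *)
Lemma approx_sa_product n h (M : R[i]) : star h = h -> 0 < M -> `|h| <= M ->
  exists2 y, D y & `|h - y| <= (3 / 4) ^+ n * M.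
Proof.
have cD : csub D by exact: csub_closed_span.
elim: n h M => [|n IHn] h M hs M0 hM.
  by exists 0; rewrite ?subr0 ?mul1r//; case: cD.
have p3 : 0 < 3 :> R[i] by [].
have p2 : 0 < 2 :> R[i] by [].
pose t := 3 / 2 * M; have t0 : 0 < t by rewrite !mulr_gt0 ?invr_gt0.
have tn0 : t != 0 by rewrite gt_eqF.
pose g := t^-1 *: h.
have gs : star g = g by rewrite starZ hs conjc_ge0// invr_ge0 ltW.
have hE : h = t *: g by rewrite scalerA mulfV ?scale1r.
have g1 : `|g| < 1.
  rewrite normrZ gtr0_norm ?invr_gt0// ltr_pdivrMl// mulr1.
  apply: le_lt_trans hM _; rewrite -[ltLHS]mul1r ltr_pM2r//.
  by rewrite ltr_pdivlMr// mul1r ltr_nat.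
have [|||y Dy yP] := IHn (t *: (g - g ** g ** g)) (3 / 4 * M).
- by rewrite starZ conjc_ge0 ?(ltW t0)// starB !starM gs amulA.
- by rewrite !mulr_gt0 ?invr_gt0.
- rewrite normrZ gtr0_norm//; apply: le_trans (ler_wpM2l (ltW t0) (sub_cube_le gs g1)) _.
  rewrite /t mulrAC -[3 / 2 / 2]mulrA -invfM -natrM.
  exact: lexx.
exists (y + t *: (g ** g ** g)).
  by apply: (csubD cD Dy); apply: (csubZ _ cD); exact: DM.
rewrite exprSr -(mulrA _ (3 / 4)); apply: le_trans yP.
by rewrite {1}hE scalerBr opprD addrA addrAC.
Qed.

Lemma closed_span_product_sa h : star h = h -> D h.
Proof.
move=> hs; have cD : csub D by exact: csub_closed_span.
apply: (csub_cl cD) => e e0.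
have M0 : 0 < `|h| + 1 by rewrite ltr_wpDl.
have [||n ne] := @expC_small R (3 / 4) (e / (`|h| + 1)).
- by rewrite divr_ge0//= ltr_pdivrMr// mul1r ltr_nat.
- by rewrite divr_gt0.
have [|y Dy hy] := approx_sa_product n hs M0; first by rewrite lerDl.
by exists y => //; apply: le_trans hy _; rewrite -ler_pdivlMr.
Qed.

Lemma closed_span_product a : closed_span [set x | exists a b, x = a ** b] a.
Proof.
have cD : csub D by exact: csub_closed_span.
have -> : a = 2^-1 *: (a + star a) + (- 'i%C / 2) *: ('i%C *: (a - star a)).
  rewrite scalerA mulrAC mulNr -expr2 sqr_i opprK mul1r -scalerDr.
  rewrite addrACA subrr addr0 -mulr2n -[a *+ 2]scaler_nat scalerA.
  by rewrite mulVf ?scale1r// pnatr_eq0.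
by apply: (csubD cD); apply: (csubZ _ cD); apply: closed_span_product_sa;
  rewrite ?starZ ?starD ?starN !starK ?conjc_i;
  by [rewrite addrC|rewrite scaleNr -scalerN opprB].
Qed.

End Idempotent.

(** * The Hahn-Banach theorem *)

Section HahnBanachReal.
Context {R : realType} {V : lmodType R[i]}.
Variable p : V -> R.
Hypothesis pD : forall x y, p (x + y) <= p x + p y.
Hypothesis pZ : forall r x, 0 <= r -> p (r%:C%C *: x) = r * p x.

(** Partial functionals are encoded as graphs so that Zorn's lemma applies to inclusion of sets.
    Single-valuedness is not imposed: two values at one point differ by a value at [0], which is at
    most [p 0 = 0]. *)
Definition dominated_graph (F : set (V * R)) : Prop :=
  (forall r x y a b, F (x, a) -> F (y, b) -> F (r%:C%C *: x + y, r * a + b)) /\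
  (forall x a, F (x, a) -> a <= p x).

Lemma dominated_graph_extend F z : F (0, 0) -> dominated_graph F ->
  exists F', [/\ dominated_graph F', F `<=` F' & exists c, F' (z, c)].
Proof.
move=> F0 [FZD Fp].
pose S := [set s | exists y a, F (y, a) /\ s = a - p (y - z)].
have Sle y b s : F (y, b) -> S s -> s <= p (y + z) - b.
  move=> Fy [x [a [Fx ->]]]; rewrite lerBlDr addrAC lerBrDr.
  apply: le_trans (_ : p (x + y) <= _).
    by apply: Fp; have := FZD 1 _ _ _ _ Fx Fy; rewrite scale1r mul1r.
  have -> : x + y = (y + z) + (x - z) by rewrite addrACA subrr addr0 addrC.
  exact: pD.
have Sn0 : S !=set0 by exists (0 - p (0 - z)), 0, 0.
(* The value at [z] has to lie above every [a - p (y - z)] and below every [p (y + z) - b]; the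
   supremum of the lower bounds does. *)
pose c := sup S.
have cl y a : F (y, a) -> a - p (y - z) <= c.
  move=> Fy; apply: ub_le_sup; last by exists y, a.
  by exists (p (0 + z) - 0) => s; exact: Sle.
have cu y b : F (y, b) -> c <= p (y + z) - b.
  by move=> Fy; apply: ge_sup => // s; exact: Sle.
exists [set w | exists y a r, F (y, a) /\ w = (y + r%:C%C *: z, a + r * c)].
split; last first.
- by exists c, 0, 0, 1; rewrite scale1r mul1r !add0r.
- by move=> [y a] Fy; exists y, a, 0; rewrite scale0r mul0r !addr0.
split.
- move=> r _ _ _ _ [x [a [s [Fx [-> ->]]]]] [y [b [t [Fy [-> ->]]]]].
  exists (r%:C%C *: x + y), (r * a + b), (r * s + t); split; first exact: FZD.
  congr (_, _).
    by rewrite scalerDr addrACA scalerA -scalerDl -rmorphM -rmorphD.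
  by rewrite mulrDr addrACA mulrA mulrDl.
- move=> _ _ [y [a [r [Fy [-> ->]]]]].
  have scale t x b : F (x, b) -> F (t%:C%C *: x, t * b).
    by move=> Fx; have := FZD t _ _ _ _ Fx F0; rewrite !addr0.
  have [r0|r0|->] := ltgtP r 0.
  + have nr0 : 0 < - r by rewrite oppr_gt0.
    have := cl _ _ (scale (- r)^-1 _ _ Fy).
    rewrite -(ler_pM2l nr0) mulrBr mulVKf ?gt_eqF// -pZ ?(ltW nr0)//.
    rewrite scalerBr scalerA -rmorphM mulfV ?gt_eqF// scale1r.
    by rewrite mulNr lerBlDr addrC -lerBlDr opprK rmorphN scaleNr opprK.
  + have := cu _ _ (scale r^-1 _ _ Fy).
    rewrite -(ler_pM2l r0) mulrBr mulVKf ?gt_eqF// -pZ ?(ltW r0)//.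
    rewrite scalerDr scalerA -rmorphM mulfV ?gt_eqF// scale1r.
    by rewrite lerBrDr addrC.
  + by rewrite scale0r mul0r !addr0; exact: Fp.
Qed.

Lemma hahn_banach_real (F : set (V * R)) : F (0, 0) -> dominated_graph F ->
  exists u : V -> R, [/\ forall r x y, u (r%:C%C *: x + y) = r * u x + u y,
    forall x a, F (x, a) -> u x = a & forall x, u x <= p x].
Proof.
move=> F0 dF.
(* Maximizing [G] with [F] adjoined, instead of requiring [G] to contain [F], also covers the empty
   chain. *)
have [|M [dM maxM]] := @Zorn_bigcup _ [set G | dominated_graph (F `|` G)].
  move=> C Cdom Ctot.
  have pick z w : (F `|` \bigcup_(X in C) X) z -> (F `|` \bigcup_(X in C) X) w ->
      exists G, [/\ dominated_graph (F `|` G), G `<=` \bigcup_(X in C) X,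
                  (F `|` G) z & (F `|` G) w].
    have sub X : C X -> X `<=` \bigcup_(X in C) X by move=> CX z' Xz'; exists X.
    move=> [Fz|[X CX Xz]] [Fw|[Y CY Yw]].
    - by exists set0; split; rewrite ?setU0.
    - by exists Y; split; [exact: Cdom|exact: sub|left|right].
    - by exists X; split; [exact: Cdom|exact: sub|right|left].
    have [XY|YX] := Ctot _ _ CX CY.
      by exists Y; split; [exact: Cdom|exact: sub|right; exact: XY|right].
    by exists X; split; [exact: Cdom|exact: sub|right|right; exact: YX].
  split=> [r x y a b Fx Fy|x a Fx].
    have [G [[GZD _] GC Gx Gy]] := pick _ _ Fx Fy.
    by have [|/GC] := GZD r _ _ _ _ Gx Gy; [left|right].
  by have [G [[_ Gp] _ Gx _]] := pick _ _ Fx Fx; exact: Gp Gx.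
have total z : exists c, (F `|` M) (z, c).
  have [F' [dF' FF' [c F'c]]] := @dominated_graph_extend _ z (or_introl F0) dM.
  exists c; apply: contrapT => nM; apply: (maxM F').
    split; first by move=> w Mw; apply: FF'; right.
    by move=> /(_ _ F'c) Mz; apply: nM; right.
  suff FE : F `|` F' = F' by rewrite /= FE.
  by apply/setUidPr => w Fw; apply: FF'; left.
have [MZD Mp] := dM.
pose u z := projT1 (cid (total z)).
have uM z : (F `|` M) (z, u z) by rewrite /u; case: cid.
have p0 : p 0 = 0 by rewrite -(scale0r 0) -(rmorph0 (real_complex R)) pZ// mul0r.
have uniq z a b : (F `|` M) (z, a) -> (F `|` M) (z, b) -> a = b.
  have le c d : (F `|` M) (z, c) -> (F `|` M) (z, d) -> d <= c.
    move=> Mc Md; have := Mp _ _ (MZD (-1) _ _ _ _ Mc Md).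
    by rewrite rmorphN1 scaleN1r addNr p0 mulN1r addrC subr_le0.
  by move=> Ma Mb; apply/eqP; rewrite eq_le !le.
exists u; split=> [r x y|x a Fx|x].
- by apply: uniq (uM _) _; exact: MZD.
- by apply: uniq (uM _) _; left.
- exact: Mp.
Qed.

End HahnBanachReal.

Section HahnBanach.
Context {R : realType} {V : normedModType R[i]}.

Lemma hahn_banach (F : set (V * R[i])) (k : R[i]) : 0 <= k -> F (0, 0) ->
  (forall c x y a b, F (x, a) -> F (y, b) -> F (c *: x + y, c * a + b)) ->
  (forall x a, F (x, a) -> `|a| <= k * `|x|) ->
  exists phi : {linear V -> R[i]^o}, continuous phi /\
    forall x a, F (x, a) -> phi x = a.
Proof.
move=> k0 F0 FZD Fk.
pose p (x : V) : R := complex.Re (k * `|x|).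
have pE x : (p x)%:C%C = k * `|x|.
  by rewrite /p RRe_real// ger0_real// mulr_ge0.
have pD x y : p (x + y) <= p x + p y.
  by rewrite -lecR rmorphD /= !pE -mulrDr ler_wpM2l// ler_normD.
have pZ r x : 0 <= r -> p (r%:C%C *: x) = r * p x.
  move=> r0; apply: complexI; rewrite rmorphM /= !pE normrZ mulrCA.
  by rewrite ger0_norm ?ler0c.
pose F' := [set w : V * R | exists a, F (w.1, a) /\ w.2 = complex.Re a].
have [||u [uZD uF up]] := hahn_banach_real pD pZ (F := F').
- by exists 0.
- split=> [r x y _ _ [a /= [Fx ->]] [b /= [Fy ->]]|x _ [a /= [Fx ->]]].
    exists (r%:C%C * a + b); split; first exact: FZD.
    by case: a b {Fx Fy} => [a1 a2] [b1 b2] /=; rewrite mul0r subr0.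
  rewrite -lecR pE; apply: le_trans (Fk _ _ Fx).
  apply: le_trans (normc_ge_Re a).
  by rewrite lecR ler_norm.
have uD x y : u (x + y) = u x + u y.
  by have := uZD 1 x y; rewrite scale1r mul1r.
have u0 : u 0 = 0 by apply: (addrI (u 0)); rewrite -uD !addr0.
have uZ r x : u (r%:C%C *: x) = r * u x.
  by have := uZD r x 0; rewrite u0 !addr0.
have uN x : u (- x) = - u x.
  by rewrite -scaleN1r -[-1]/(- 1%:C%C) -rmorphN uZ mulN1r.
(* The complex-linear functional with real part [u]. *)
pose g (x : V) : R[i]^o := (u x)%:C%C - 'i%C * (u ('i%C *: x))%:C%C.
have gD x y : g (x + y) = g x + g y.
  by rewrite /g scalerDr !uD !rmorphD mulrDr opprD addrACA.
have ii : 'i%C * 'i%C = -1 :> R[i] by rewrite -expr2 sqr_i.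
have gr r x : g (r%:C%C *: x) = r%:C%C * g x.
  have e : 'i%C *: (r%:C%C *: x) = r%:C%C *: ('i%C *: x).
    by rewrite !scalerA mulrC.
  by rewrite /g e !uZ !rmorphM mulrBr mulrCA.
have gi x : g ('i%C *: x) = 'i%C * g x.
  rewrite /g scalerA ii scaleN1r uN rmorphN mulrBr mulrA ii mulN1r mulrN !opprK.
  by rewrite addrC.
have gL : linear g.
  move=> c x y; rewrite gD; congr (_ + _).
  rewrite (complexE c) scalerDl gD gr -scalerA gi gr mulrA.
  by rewrite -mulrDl.
have uk x : `|(u x)%:C%C| <= k * `|x|.
  rewrite -pE normc_def /= expr0n addr0 sqrtr_sqr lecR ler_norml up andbT.
  rewrite lerNl -uN; apply: le_trans (up _) _.
  by rewrite /p normrN.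
pose phi : {linear V -> R[i]^o} := HB.pack g (GRing.isLinear.Build _ _ _ _ g gL).
exists phi; split=> [|x a Fx].
  apply: bounded_linear_continuous; apply/linear_boundedP.
  (* Only continuity is claimed, so bounding the two terms of [g] separately, by [k] each,
     suffices. *)
  near=> r => x; apply: le_trans (_ : (k + k) * `|x| <= _); last first.
    by rewrite ler_wpM2r//; near: r; apply: nbhs_pinfty_ge; rewrite ger0_real ?addr_ge0.
  rewrite /= /g mulrDl; apply: le_trans (ler_normB _ _) _.
  rewrite lerD ?uk// normrM.
  have i1 : `|'i%C| = 1 :> R[i] by rewrite normc_def /= expr0n expr1n add0r sqrtr1.
  rewrite i1.
  by rewrite mul1r (le_trans (uk _))// normrZ i1 mul1r.
(* The real part of ['i * a] is minus the imaginary part of [a], so the two values of [u] reassemble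
   [a]. *)
rewrite /= /g (uF _ (complex.Re a)); last by exists a.
rewrite (uF _ (complex.Re ('i%C * a))); last first.
  exists ('i%C * a); split => //.
  by have := FZD 'i%C _ _ _ _ Fx F0; rewrite !addr0.
by rewrite [RHS]complexE; case: a {Fx} => a b /=;
  rewrite mul0r mul1r sub0r rmorphN mulrN opprK.
Unshelve. all: by end_near. Qed.
End HahnBanach.

(** * C*-subalgebras *)

Record csubalg (R : realType) (B : cstarAlgType R) := CSubAlg {
  csubalg_set :> B -> Prop;
  csubalg_csub : csub csubalg_set;
  csubalgM : forall x y, csubalg_set x -> csubalg_set y -> csubalg_set (x ** y);
  csubalgS : forall x, csubalg_set x -> csubalg_set (star x)
}.

Section SubAlgebra.
Context {R : realType} {B : cstarAlgType R} (W : csubalg B).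

Definition csubalg_pred : {pred B} := fun x => `[< W x >].

Fact csubalg_submod_closed : submod_closed csubalg_pred.
Proof.
have cW := csubalg_csub W.
split; first by apply/asboolP; case: cW.
by move=> c x y /asboolP Wx /asboolP Wy; apply/asboolP; exact: csubZD.
Qed.
HB.instance Definition _ :=
  GRing.isSubmodClosed.Build R[i] B csubalg_pred csubalg_submod_closed.

Definition csubalg_type := {x : B | csubalg_pred x}.
HB.instance Definition _ := [isSub of csubalg_type for @sval _ _].
HB.instance Definition _ := [Choice of csubalg_type by <:].
HB.instance Definition _ := [SubChoice_isSubLmodule of csubalg_type by <:].

Implicit Types x y : csubalg_type.

Lemma csubalg_valP x : W (val x).
Proof. exact/asboolP/(valP x). Qed.

Definition to_csubalg (b : B) (Wb : W b) : csubalg_type :=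
  Sub b (introT (asboolP _) Wb).

Lemma val_to_csubalg b (Wb : W b) : val (to_csubalg Wb) = b.
Proof. exact: SubK. Qed.

Let norm x : R[i] := `|val x|.
Fact csubalg_normD x y : norm (x + y) <= norm x + norm y.
Proof. by rewrite /norm raddfD ler_normD. Qed.
Fact csubalg_normZ (c : R[i]) x : norm (c *: x) = `|c| * norm x.
Proof. by rewrite /norm linearZ normrZ. Qed.
Fact csubalg_norm0 x : norm x = 0 -> x = 0.
Proof. by move=> /normr0_eq0 h; apply: val_inj; rewrite h raddf0. Qed.
HB.instance Definition _ := Lmodule_isNormed.Build R[i] csubalg_type
  csubalg_normD csubalg_normZ csubalg_norm0.

Lemma csubalg_normE x : `|x| = `|val x|.
Proof. by []. Qed.

(** The limit is built in [B] from centres of small balls belonging to the filter, and lies in [W]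
    because [W] is closed. *)
Fact csubalg_complete (F : set_system csubalg_type) :
  ProperFilter F -> cauchy F -> cvg F.
Proof.
move=> FF /cauchyP cF.
pose P e b := exists2 x : csubalg_type, b = val x & F (ball x e).
have Pex e : 0 < e -> exists b, P e b.
  by move=> /cF[x Fx]; exists (val x), x.
have PP e b d c : 0 < e -> 0 < d -> P e b -> P d c -> `|b - c| <= e + d.
  move=> e0 d0 [x -> Fx] [y -> Fy].
  have [z []] := filter_ex (filterI Fx Fy).
  rewrite -!ball_normE /= !csubalg_normE !raddfB /= => xz yz.
  rewrite -(subrK (val z) (val x)) -addrA; apply: le_trans (ler_normD _ _) _.
  by rewrite lerD// ?[`|val z - _|]distrC ltW.
have [l Pl] := complete_approx Pex PP.
have Wl : W l.
  apply: (csub_cl (csubalg_csub W)) => e e0; have [b Pb] := Pex _ e0.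
  exists b; last by rewrite distrC; exact: Pl Pb.
  by case: Pb => x -> _; exact: csubalg_valP.
apply/cvg_ex; exists (to_csubalg Wl); apply/fcvg_ballP => e e0.
have e20 : 0 < e / 2 by rewrite divr_gt0.
have [b Pb] := Pex _ e20; have := Pl _ _ e20 Pb.
case: Pb => x -> Fx xl; apply: filterS Fx => z.
rewrite -!ball_normE /= !csubalg_normE !raddfB /= => xz.
rewrite -(subrK (val x) l) -addrA; apply: le_lt_trans (ler_normD _ _) _.
by rewrite [ltRHS]splitr ler_ltD// distrC.
Qed.
HB.instance Definition _ := Uniform_isComplete.Build csubalg_type csubalg_complete.

Definition csubalg_mul x y : csubalg_type :=
  to_csubalg (csubalgM (csubalg_valP x) (csubalg_valP y)).
Definition csubalg_star x : csubalg_type :=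
  to_csubalg (csubalgS (csubalg_valP x)).

Fact csubalg_mulA : associative csubalg_mul.
Proof. by move=> x y z; apply: val_inj; rewrite /= amulA. Qed.
Fact csubalg_mulDl : left_distributive csubalg_mul +%R.
Proof. by move=> x y z; apply: val_inj; rewrite !raddfD/= amulDl. Qed.
Fact csubalg_mulDr : right_distributive csubalg_mul +%R.
Proof. by move=> x y z; apply: val_inj; rewrite !raddfD/= amulDr. Qed.
Fact csubalg_mulZl (c : R[i]) x y :
  csubalg_mul (c *: x) y = c *: csubalg_mul x y.
Proof. by apply: val_inj; rewrite !linearZ/= amulZl. Qed.
Fact csubalg_mulZr (c : R[i]) x y :
  csubalg_mul x (c *: y) = c *: csubalg_mul x y.
Proof. by apply: val_inj; rewrite !linearZ/= amulZr. Qed.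
Fact csubalg_starK : involutive csubalg_star.
Proof. by move=> x; apply: val_inj; rewrite /= starK. Qed.
Fact csubalg_starD : {morph csubalg_star : x y / x + y}.
Proof. by move=> x y; apply: val_inj; rewrite !raddfD/= starD. Qed.
Fact csubalg_starZ (c : R[i]) x : csubalg_star (c *: x) = conjc c *: csubalg_star x.
Proof. by apply: val_inj; rewrite !linearZ/= starZ. Qed.
Fact csubalg_starM x y :
  csubalg_star (csubalg_mul x y) = csubalg_mul (csubalg_star y) (csubalg_star x).
Proof. by apply: val_inj; rewrite /= starM. Qed.
HB.instance Definition _ := isStarAlgebra.Build R csubalg_type
  csubalg_mulA csubalg_mulDl csubalg_mulDr csubalg_mulZl csubalg_mulZr
  csubalg_starK csubalg_starD csubalg_starZ csubalg_starM.

Fact csubalg_normM x y : `|x ** y| <= `|x| * `|y|.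
Proof. exact: normAM_le. Qed.
Fact csubalg_norm_star x : `|star x ** x| = `|x| ^+ 2.
Proof. exact: normA_star. Qed.
HB.instance Definition _ := isCStarAlgebra.Build R csubalg_type
  csubalg_normM csubalg_norm_star.

Lemma val_amul x y : val (x ** y) = val x ** val y.
Proof. by []. Qed.

Lemma val_add x y : val (x + y) = val x + val y.
Proof. by []. Qed.

Lemma val_scale (c : R[i]) x : val (c *: x) = c *: val x.
Proof. by []. Qed.

Lemma val_star x : val (star x) = star (val x).
Proof. by []. Qed.

Definition stabilizes (T : multiplier B) : Prop :=
  (forall b, W b -> W (mulL T b)) /\ (forall b, W b -> W (mulR T b)).

Fact restrict_subproof T (hT : stabilizes T) x y :
  x ** to_csubalg (hT.1 _ (csubalg_valP y)) =
  to_csubalg (hT.2 _ (csubalg_valP x)) ** y.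
Proof. by apply: val_inj; rewrite !val_amul !val_to_csubalg multiplierP. Qed.

(* Junk value 0 if T does not stabilize W. *)
Definition restrict (T : multiplier B) : multiplier csubalg_type :=
  if pselect (stabilizes T) is left hT then Multiplier (restrict_subproof hT)
  else 0.

Lemma val_restrict T x : stabilizes T -> val (mulL (restrict T) x) = mulL T (val x).
Proof. by rewrite /restrict; case: pselect. Qed.

Lemma val_restrictR T x : stabilizes T -> val (mulR (restrict T) x) = mulR T (val x).
Proof. by rewrite /restrict; case: pselect. Qed.

Lemma stabilizes_star T : stabilizes T -> stabilizes (star T).
Proof.
by move=> [TL TR]; split=> b Wb; apply: csubalgS;
  [apply: TR|apply: TL]; exact: csubalgS.
Qed.

Lemma stabilizesM S T : stabilizes S -> stabilizes T -> stabilizes (S ** T).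
Proof. by move=> [SL SR] [TL TR]; split=> b Wb /=; auto. Qed.

Lemma restrictM S T : stabilizes S -> stabilizes T ->
  restrict (S ** T) = restrict S ** restrict T.
Proof.
move=> hS hT; apply: multiplier_extL => x; apply: val_inj.
by rewrite mulL_mul !val_restrict//; exact: stabilizesM.
Qed.

Lemma restrict_star T : stabilizes T -> restrict (star T) = star (restrict T).
Proof.
move=> hT; apply: multiplier_extL => x; apply: val_inj.
rewrite val_restrict; last exact: stabilizes_star.
by rewrite !mulL_star val_star val_restrictR.
Qed.

Lemma restrict_star_hom (C : starAlgType R) (f : C -> multiplier B) :
  star_hom f -> (forall c, stabilizes (f c)) -> star_hom (restrict \o f).
Proof.
move=> hf sf; split=> [c x y|x y|x] /=.
- apply: multiplier_extL => z; apply: val_inj.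
  rewrite mulL_add mulL_scale val_add val_scale !val_restrict//.
  by rewrite (star_hom_linear hf) mulL_add mulL_scale.
- by rewrite (star_homM hf) restrictM.
- by rewrite (star_homS hf) restrict_star.
Qed.

End SubAlgebra.

(** * Extending a homomorphism from M(W) to M(B) *)

Section Lift.
Context {R : realType} {X B : cstarAlgType R} (W : csubalg B) (Y : set B).
Variable Phi : X -> multiplier (csubalg_type W).
Hypotheses (cY : csub Y) (WY : forall z, Y z -> W (z ** star z)).
Hypothesis hPhi : star_hom Phi.
Implicit Types (x : X) (S T : multiplier B) (b z : B).

(** [T] is a candidate for the image of [x] in the multipliers of [B]. The range conditions pin it
    down, and the clauses on [star T] make the relation stable under adjoints. *)
Record lifts x T : Prop := {
  lifts_eq : forall w : csubalg_type W, mulL T (val w) = val (mulL (Phi x) w);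
  lifts_starE : forall w : csubalg_type W,
    mulL (star T) (val w) = val (mulL (Phi (star x)) w);
  lifts_im : forall b, Y (mulL T b);
  lifts_star_im : forall b, Y (mulL (star T) b)
}.

Lemma lifts_star x T : lifts x T -> lifts (star x) (star T).
Proof. by case=> *; split; rewrite ?starK. Qed.

Lemma liftsZD c x1 x2 T1 T2 :
  lifts x1 T1 -> lifts x2 T2 -> lifts (c *: x1 + x2) (c *: T1 + T2).
Proof.
case=> e1 s1 i1 j1 [e2 s2 i2 j2]; split=> [w|w|b|b].
- by rewrite mulL_add mulL_scale e1 e2 (star_hom_linear hPhi).
- rewrite !starD !starZ mulL_add mulL_scale s1 s2.
  by rewrite (star_hom_linear hPhi).
- by rewrite mulL_add mulL_scale; exact: csubZD.
- by rewrite starD starZ mulL_add mulL_scale; exact: csubZD.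
Qed.

Lemma lifts0 : lifts 0 0.
Proof.
have Y0 : Y 0 by case: cY.
by split=> [w|w|b|b]; rewrite ?star0 ?(star_hom0 hPhi).
Qed.

Lemma liftsM x1 x2 T1 T2 :
  lifts x1 T1 -> lifts x2 T2 -> lifts (x1 ** x2) (T1 ** T2).
Proof.
case=> e1 s1 i1 j1 [e2 s2 i2 j2]; split=> [w|w|b|b].
- by rewrite mulL_mul e2 e1 (star_homM hPhi).
- by rewrite !starM mulL_mul s1 s2 (star_homM hPhi).
- by rewrite mulL_mul.
- by rewrite starM mulL_mul.
Qed.

(* On Y the bound comes from z z^* in W; in general T b is in Y, so that
   |T b|^2 <= |b| |T^* (T b)| reduces to that case. *)
Lemma lifts_norm x T b : lifts x T -> `|mulL T b| <= `|x| * `|b|.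
Proof.
move=> lT.
have normY x' T' z : lifts x' T' -> Y z -> `|mulL T' z| <= `|x'| * `|z|.
  move=> [e' _ _ _] /WY Wz.
  have TW w : W w -> W (mulL T' w) /\ `|mulL T' w| <= `|x'| * `|w|.
    move=> Ww; have := e' (to_csubalg Ww); rewrite val_to_csubalg => ->.
    split; first exact: csubalg_valP.
    have := star_hom_le hPhi x' (to_csubalg Ww).
    by rewrite !csubalg_normE val_to_csubalg.
  have [Wtz tz] := TW _ Wz; have [_ ttz] := TW _ (csubalgS Wtz).
  rewrite -(ler_pXn2r (ltn0Sn 1))// ?nnegrE ?mulr_ge0//.
  (* For [w = z ** star z] in [W], the square of [|T' z|] is the norm of [T'] applied to
     [star (T' w)]. Both [w] and [star (T' w)] lie in [W], where contractivity of [Phi] is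
     available. *)
  rewrite -normA_starr -mulLM.
  have <- : star (mulL T' (z ** star z)) = z ** star (mulL T' z).
    by rewrite mulLM starM starK.
  apply: le_trans ttz _; rewrite norm_star.
  apply: le_trans (ler_wpM2l (normr_ge0 _) tz) _.
  by rewrite normA_starr exprMn mulrA -expr2.
apply: sqr_le_mul; rewrite ?mulr_ge0//.
rewrite -normA_star star_mulL_mul mulL_mul.
apply: le_trans (normAM_le _ _) _; rewrite norm_star.
have := normY _ _ _ (lifts_star lT) (lifts_im lT b); rewrite norm_star => h.
by apply: le_trans (ler_wpM2l (normr_ge0 _) h) _; rewrite mulrCA mulrA.
Qed.

Lemma lifts_dist x1 x2 T1 T2 b : lifts x1 T1 -> lifts x2 T2 ->
  `|mulL T1 b - mulL T2 b| <= `|x1 - x2| * `|b|.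
Proof.
move=> l1 l2; have := lifts_norm b (liftsZD (-1) l2 l1).
by rewrite mulL_add mulL_scale !scaleN1r ![- _ + _]addrC.
Qed.

(** The norm bound for the difference, which lifts [0], makes the relation single-valued. *)
Lemma lifts_uniq x T1 T2 : lifts x T1 -> lifts x T2 -> T1 = T2.
Proof.
move=> l1 l2; apply: multiplier_extL => b.
have := lifts_dist b l1 l2; rewrite subrr normr0 mul0r normr_le0 subr_eq0.
by move/eqP.
Qed.

Lemma approx_eq0 (D : set X) x (k t : R[i]) :
  (forall e, 0 < e -> exists2 x', D x' & `|x - x'| <= e) ->
  0 <= k -> 0 <= t -> (forall x', D x' -> t <= k * `|x - x'|) -> t = 0.
Proof.
move=> Dx k0 t0 tk; apply: le0_eps => // e e0.
have k1 : 0 < k + 1 by rewrite ltr_wpDl.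
have [|x' Dx' xx'] := Dx (e / (k + 1)); first by rewrite divr_gt0.
apply: le_trans (tk _ Dx') _; move: xx'; rewrite ler_pdivlMr// mulrC.
by apply: le_trans; rewrite ler_wpM2r// lerDl.
Qed.

Let D := [set x | exists T, lifts x T].

(** By [lifts_dist], the vectors [mulL T' b] form a Cauchy family as [x'] tends to [x]; [L b] is
    their limit, with an explicit rate. *)
Lemma lifts_limit x : (forall e, 0 < e -> exists2 x', D x' & `|x - x'| <= e) ->
  exists L : B -> B, forall x' T' b, lifts x' T' ->
    `|mulL T' b - L b| <= `|x - x'| * `|b|.
Proof.
move=> Dx; suff /choice[L LP] : forall b, exists l, forall x' T', lifts x' T' ->
    `|mulL T' b - l| <= `|x - x'| * `|b|.
  by exists L => x' T' b; exact: LP.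
move=> b.
pose P e y := exists x' T', [/\ lifts x' T', `|x - x'| * `|b| <= e & y = mulL T' b].
have [||l Pl] := @complete_approx _ B P.
- move=> e e0; have b0 : 0 < `|b| + 1 by rewrite ltr_wpDl.
  have [|x' [T' lT'] xx'] := Dx (e / (`|b| + 1)); first by rewrite divr_gt0.
  exists (mulL T' b), x', T'; split => //; move: xx'; rewrite ler_pdivlMr//.
  by apply: le_trans; rewrite ler_wpM2l// lerDl.
- move=> e _ d _ e0 d0 [x1 [T1 [l1 h1 ->]]] [x2 [T2 [l2 h2 ->]]].
  apply: le_trans (lifts_dist b l1 l2) _.
  apply: le_trans (lerD h1 h2); rewrite -mulrDl ler_wpM2r//.
  by rewrite -(subrKA x) -[`|x - x1|]distrC ler_normD.
exists l => x' T' lT'; apply/ler_addgt0Pr => e e0.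
apply: Pl; first by rewrite ltr_wpDl// mulr_ge0.
by exists x', T'; split => //; rewrite lerDl ltW.
Qed.

Lemma lifts_limitP x (L : B -> B) :
  (forall e, 0 < e -> exists2 x', D x' & `|x - x'| <= e) ->
  (forall x' T' b, lifts x' T' -> `|mulL T' b - L b| <= `|x - x'| * `|b|) ->
  (forall w, L (val w) = val (mulL (Phi x) w)) /\ (forall b, Y (L b)).
Proof.
move=> Dx LP; split=> [w|b].
  apply/eqP; rewrite -subr_eq0 -normr_eq0; apply/eqP.
  apply: (approx_eq0 Dx (k := `|val w| + `|val w|)) => //.
  move=> x' [T' lT'].
  rewrite -(subrKA (mulL T' (val w))); apply: le_trans (ler_normD _ _) _.
  rewrite mulrDl lerD//; first by rewrite distrC mulrC LP.
  rewrite (lifts_eq lT') distrC.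
  have := star_hom_le hPhi (x - x') w.
  by rewrite (star_homD hPhi) (star_homN hPhi) mulL_add mulL_opp
    !csubalg_normE raddfB mulrC.
apply: (csub_cl cY) => e e0; have b0 : 0 < `|b| + 1 by rewrite ltr_wpDl.
have [|x' [T' lT'] xx'] := Dx (e / (`|b| + 1)); first by rewrite divr_gt0.
exists (mulL T' b); first exact: lifts_im lT' b.
rewrite distrC; apply: le_trans (LP _ _ _ lT') _.
move: xx'; rewrite ler_pdivlMr//.
by apply: le_trans; rewrite ler_wpM2l// lerDl.
Qed.

(** For closedness, let [L] and [L'] be the limits of the approximating lifts and of their adjoints.
    Then [L] and [a |-> star (L' (star a))] form a double centralizer, which lifts the limit
    point. *)
Lemma csub_lifts : csub D.
Proof.
split; first by exists 0; exact: lifts0.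
  by move=> c x y [S lS] [T lT]; exists (c *: S + T); exact: liftsZD.
move=> x Dx.
have Dx' e : 0 < e -> exists2 x', D x' & `|star x - x'| <= e.
  move=> /Dx[x' [T' lT'] xx']; exists (star x').
    by exists (star T'); exact: lifts_star.
  by rewrite -starB norm_star.
have [L LP] := lifts_limit Dx; have [L' LP'] := lifts_limit Dx'.
have LL' a b : a ** L b = star (L' (star a)) ** b.
  apply/eqP; rewrite -subr_eq0 -normr_eq0; apply/eqP.
  apply: (approx_eq0 Dx (k := `|a| * `|b| + `|a| * `|b|)) => //.
  move=> x' [T' lT'].
  have -> : a ** L b - star (L' (star a)) ** b =
      (star (mulL (star T') (star a) - L' (star a))) ** b - a ** (mulL T' b - L b).
    rewrite starB amulDl amulDr star_mulNl star_mulNr opprB.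
    rewrite multiplierP -[T' in mulR T' a]starK mulR_star.
    by rewrite [RHS]addrC subrKA.
  apply: le_trans (ler_normB _ _) _; rewrite mulrDl lerD//.
    apply: le_trans (normAM_le _ _) _; rewrite norm_star.
    rewrite mulrAC ler_wpM2r// mulrC -[`|a|]norm_star.
    apply: le_trans (LP' _ _ _ (lifts_star lT')) _.
    by rewrite -starB norm_star.
  apply: le_trans (normAM_le _ _) _; rewrite -mulrA ler_wpM2l// mulrC.
  exact: LP.
pose T := Multiplier LL'.
have starT b : mulL (star T) b = L' b by rewrite mulL_star /= !starK.
have [Lw LY] := lifts_limitP Dx LP; have [L'w L'Y] := lifts_limitP Dx' LP'.
by exists T; split=> [w|w|b|b]; rewrite ?starT.
Qed.

(* The graph of the extended homomorphism is the relation [lifts]. *)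
Lemma lift_star_hom (S : set X) : closed_span S = [set: X] -> S `<=` D ->
  exists2 Psi : X -> multiplier B, star_hom Psi & forall x, lifts x (Psi x).
Proof.
move=> spanS SD.
have /choice[Psi PsiP] x : D x.
  by apply: (closed_span_sub csub_lifts SD); rewrite spanS.
exists Psi => //; split=> [c x y|x y|x]; apply: lifts_uniq (PsiP _) _.
- exact: liftsZD.
- exact: liftsM.
- exact: lifts_star.
Qed.

End Lift.

(** * Integrated forms *)

Section Integrated.
Context {R : realType} {V : normedModType R[i]}.

(** A point outside [W] has some positive distance bound [d] to it, so [y + c *: z |-> c] on the
    span of [W] and [z] is bounded by [d^-1] and extends by Hahn-Banach. *)
Lemma separate_csub (W : set V) z : csub W -> ~ W z ->
  exists phi : {linear V -> R[i]^o},
    [/\ continuous phi, forall y, W y -> phi y = 0 & phi z = 1].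
Proof.
move=> cW Wz.
have [d d0 dW] : exists2 d : R[i], 0 < d & forall y, W y -> d <= `|z - y|.
  apply: contrapT => nd; apply: Wz; apply: (csub_cl cW) => e e0.
  apply: contrapT => ne; apply: nd; exists e => // y Wy.
  have := real_leVge (ger0_real (ltW e0)) (normr_real (z - y)).
  by case/orP => // zy; exfalso; apply: ne; exists y.
pose F := [set w : V * R[i] | exists2 y, W y & w.1 = y + w.2 *: z].
have [||c x y a b [x' Wx /= ->] [y' Wy /= ->]|x c [y Wy /= ->]|phi [cphi phiF]] :=
    @hahn_banach R V F d^-1.
- by rewrite invr_ge0 ltW.
- by exists 0; rewrite ?scale0r ?addr0//; case: cW.
- exists (c *: x' + y'); first exact: csubZD.
  by rewrite scalerDr scalerA addrACA -scalerDl.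
- rewrite ler_pdivlMl//; have [->|c0] := eqVneq c 0.
    by rewrite normr0 mulr0.
  have -> : y + c *: z = c *: (z - (- c^-1) *: y).
    by rewrite scaleNr opprK scalerDr scalerA mulfV// scale1r addrC.
  by rewrite normrZ mulrC ler_wpM2l// dW//; exact: csubZ.
exists phi; split=> // [y Wy|]; apply: phiF.
  by exists y; rewrite //= scale0r addr0.
by exists 0; rewrite /= ?scale1r ?add0r//; case: cW.
Qed.

Lemma haar0 (G : lcGroupType) (I : (G -> R[i]) -> R[i]) :
  is_haar I -> I (fun=> 0) = 0.
Proof.
move=> hI.
have C0 : Cc (fun _ : G => 0 : R[i]).
  split; first by move=> x; exact: cvg_cst.
  by exists set0; split => //; exact: compact0.
have := haar_linear hI 1 C0 C0.
under [X in I X = _]eq_fun do rewrite mulr0 addr0.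
by rewrite mul1r => /(congr1 (fun t => t - I (fun=> 0))); rewrite subrr addrK.
Qed.

End Integrated.

Section IntegratedForm.
Context {R : realType} {G : lcGroupType} {CG : groupCStar R G}.
Context {B : cstarAlgType R} {u : G -> multiplier B} {uC : gc_alg CG -> multiplier B}.
Hypothesis huC : integrated_form u uC.

(** If [uC] of an element from [Cc] moved [b] out of [W], a functional vanishing on [W] and equal to
    1 at the image would give 1 as the integral of the zero function. Density and contractivity
    handle the other [c]. *)
Lemma integrated_form_csub (W : set B) b : csub W ->
  (forall s, W (mulL (u s) b)) -> forall c, W (mulL (uC c) b).
Proof.
move=> cW Wu c; have [hom int] := huC.
have cpre : csub [set c | W (mulL (uC c) b)].
  apply: (csub_preim (k := `|b|) (s := id) cW) => // [x y|a x|x].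
  - by rewrite (star_homD hom) mulL_add.
  - by rewrite (star_homZ hom) mulL_scale.
  - by rewrite mulrC; exact: star_hom_le.
apply: (csub_cl cpre) => e e0.
have /closure_normP/(_ _ e0)[_ [f Cf <-] cf] :
    closure [set gc_of CG f | f in @Cc R G] c by rewrite gc_dense.
exists (gc_of CG f) => //=; apply: contrapT => nW.
have [phi [cphi phiW phi1]] := separate_csub cW nW.
have := int f Cf b phi cphi; rewrite phi1.
under [X in gc_haar CG X]eq_fun do rewrite phiW// mulr0.
by rewrite (haar0 (gc_haarP CG)) => /eqP; rewrite oner_eq0.
Qed.

End IntegratedForm.

Section SubAlgebraIntegrated.
Context {R : realType} {B : cstarAlgType R} {W : csubalg B}.

Lemma csubalg_continuous (T : topologicalType) (f : T -> csubalg_type W) :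
  continuous (val \o f) -> continuous f.
Proof.
move=> cf t; apply/cvgrPdist_lt => e e0.
have /cvgrPdist_lt/(_ _ e0) := cf t.
by apply: filterS => s /=; rewrite csubalg_normE raddfB.
Qed.

(** Each continuous functional on the subalgebra extends to [B] by Hahn-Banach, and the weak
    integral formula known in [B] is applied to the extension. *)
Lemma restrict_integrated_form (G : lcGroupType) (CG : groupCStar R G)
    (u : G -> multiplier B) (uC : gc_alg CG -> multiplier B) :
  (forall s, stabilizes W (u s)) -> (forall c, stabilizes W (uC c)) ->
  integrated_form u uC ->
  integrated_form (restrict W \o u) (restrict W \o uC).
Proof.
move=> su sC [hom int]; split; first exact: restrict_star_hom.
move=> f Cf b phi cphi.
have [k k0 phik] : exists2 k, 0 <= k & forall x, `|phi x| <= k * `|x|.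
  have /linear_bounded_continuous/linear_boundedP/pinfty_ex_gt0[k k0 phik] := cphi.
  by exists k => //; exact: ltW.
pose F := [set w : B * R[i] | exists x : csubalg_type W, w.1 = val x /\ w.2 = phi x].
have [||c x y _ _ [x' [/= -> ->]] [y' [/= -> ->]]|x c [y [/= -> ->]]|psi [cpsi psiF]] :=
    @hahn_banach R B F k.
- exact: k0.
- by exists 0; rewrite /= linear0.
- by exists (c *: x' + y'); rewrite /= linearP.
- exact: phik.
have psiE x : psi (val x) = phi x by apply: psiF; exists x.
rewrite -psiE /= val_restrict// int//.
by congr (gc_haar CG _); apply/funext => s /=; rewrite -psiE val_restrict.
Qed.

Lemma restrict_strict_unitary (G : lcGroupType) (u : G -> multiplier B) :
  (forall s, stabilizes W (u s)) -> strict_unitary_hom u ->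
  strict_unitary_hom (restrict W \o u).
Proof.
have r1 : restrict W mone = mone.
  apply: multiplier_extL => x; apply: val_inj.
  by rewrite val_restrict//; split.
move=> su hu; split=> /= [s t|s|s|b|b].
- by rewrite (uhomM hu) restrictM.
- by rewrite -restrict_star// -restrictM ?(uhom_unitaryl hu)//; exact: stabilizes_star.
- by rewrite -restrict_star// -restrictM ?(uhom_unitaryr hu)//; exact: stabilizes_star.
- apply: csubalg_continuous.
  rewrite (_ : _ \o _ = fun s => mulL (u s) (val b)); first exact: uhom_strictL.
  by apply/funext => s; exact: val_restrict.
- apply: csubalg_continuous.
  rewrite (_ : _ \o _ = fun s => mulR (u s) (val b)); first exact: uhom_strictR.
  by apply/funext => s; exact: val_restrictR.
Qed.

Lemma restrict_covariant (G : lcGroupType) (A : cstarAlgType R)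
    (alpha : G -> A -> A) (pi : A -> multiplier B) (u : G -> multiplier B) :
  (forall a, stabilizes W (pi a)) -> (forall s, stabilizes W (u s)) ->
  covariant_hom alpha pi u ->
  covariant_hom alpha (restrict W \o pi) (restrict W \o u).
Proof.
move=> sp su [hpi hu cov]; split=> [||s a] /=.
- exact: restrict_star_hom.
- exact: restrict_strict_unitary.
rewrite cov -restrict_star// !restrictM//; do ?exact: stabilizes_star.
exact: stabilizesM.
Qed.

End SubAlgebraIntegrated.

(** * The ideal generated by pi(A) *)

Section RangeIdeal.
Context {R : realType} {A B : cstarAlgType R} {rho : A -> multiplier B}.
Hypothesis hrho : star_hom rho.
Implicit Types (a : A) (b y z : B) (T : multiplier B).

Definition range_ideal : set B :=
  closed_span [set y | exists a b, y = mulL (rho a) b].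
Local Notation Y := range_ideal.

Lemma csub_range : csub Y. Proof. exact: csub_closed_span. Qed.

Lemma range_ideal_gen a b : Y (mulL (rho a) b).
Proof. by apply: sub_closed_span; exists a, b. Qed.

Lemma range_stable (f : B -> B) (s : R[i] -> R[i]) (k : R[i]) :
  {morph f : x y / x + y} -> (forall c x, f (c *: x) = s c *: f x) ->
  0 <= k -> (forall x, `|f x| <= k * `|x|) ->
  (forall a b, Y (f (mulL (rho a) b))) -> forall y, Y y -> Y (f y).
Proof.
move=> fD fZ k0 fk fY.
apply: (closed_span_sub (csub_preim csub_range fD fZ k0 fk)).
by move=> _ [a [b ->]]; exact: fY.
Qed.

Lemma range_amul y b : Y y -> Y (y ** b).
Proof.
apply: (range_stable (f := fun x => x ** b) (s := id) (k := `|b|)) => //.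
- by move=> x z; rewrite amulDl.
- by move=> c x; rewrite amulZl.
- by move=> x; rewrite mulrC normAM_le.
- by move=> a c /=; rewrite -mulLM; exact: range_ideal_gen.
Qed.

Lemma range_mulR T k y : 0 <= k -> (forall b, `|mulL T b| <= k * `|b|) ->
  Y y -> Y (mulR T y).
Proof.
move=> k0 Tk; apply: (range_stable (f := mulR T) (s := id) (k := k)) => //.
- exact: mulRD.
- exact: mulRZ.
- exact: mulR_le.
- by move=> a b; rewrite mulLR; exact: range_ideal_gen.
Qed.

Lemma csub_range_star : csub (Y `&` [set b | Y (star b)]).
Proof.
apply: csubI; first exact: csub_range.
apply: (csub_preim (s := conjc) (k := 1) csub_range) => //.
- exact: starD.
- exact: starZ.
- by move=> x; rewrite norm_star mul1r.
Qed.

Fact range_starM x y : (Y `&` [set b | Y (star b)]) x ->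
  (Y `&` [set b | Y (star b)]) y -> (Y `&` [set b | Y (star b)]) (x ** y).
Proof. by move=> [Yx _] [_ Yy]; split; rewrite /= ?starM; exact: range_amul. Qed.

Fact range_starS x : (Y `&` [set b | Y (star b)]) x ->
  (Y `&` [set b | Y (star b)]) (star x).
Proof. by move=> [Yx Ysx]; split; rewrite /= ?starK. Qed.

Definition range_alg : csubalg B :=
  CSubAlg csub_range_star range_starM range_starS.
Local Notation W := range_alg.

Lemma range_alg_amul_star z : Y z -> W (z ** star z).
Proof.
by move=> Yz; split; rewrite /= ?starM ?starK; exact: range_amul.
Qed.

(** Right actions of bounded multipliers preserve [Y] automatically. Since
    [star (mulL T b) = mulR (star T) (star b)], only the left actions of [T] and [star T] need
    checking. *)
Lemma stabilizes_range T k : 0 <= k -> (forall b, `|mulL T b| <= k * `|b|) ->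
  (forall y, Y y -> Y (mulL T y)) -> (forall y, Y y -> Y (mulL (star T) y)) ->
  stabilizes W T.
Proof.
move=> k0 Tk YT YsT; split=> b [Yb Ysb]; split => /=.
- exact: YT.
- rewrite -[b]starK -mulR_star; apply: (range_mulR k0) => //.
  exact: mulL_star_le.
- exact: (range_mulR k0 Tk).
- by rewrite -[b]starK -mulL_star; exact: YsT.
Qed.

Lemma stabilizes_pi a : stabilizes W (rho a).
Proof.
apply: (stabilizes_range (normr_ge0 a)) => [b|y _|y _].
- exact: star_hom_le.
- exact: range_ideal_gen.
- by rewrite -(star_homS hrho); exact: range_ideal_gen.
Qed.

(** [W] is spanned by products [y ** x] with factors in [W]. Here [y] is approximated by sums of
    [pi(a) b] and [a] by sums of [c ** d], and [pi(c ** d) b x = pi(c) (pi(d) b x)], where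
    [pi(d) b x] lies in [W]. *)
Lemma restrict_nondegenerate : Defs.nondegenerate (restrict W \o rho).
Proof.
rewrite /Defs.nondegenerate; set N := closed_span _.
have cN : csub N by exact: csub_closed_span.
(* The intermediate vectors [pi(a) b] need not lie in [W], so the approximation is carried out in
   [B] and brought back at the end. *)
pose N' := closure [set val x | x in N].
have cN' : csub N'.
  apply: csub_closure; first by exists 0 => //; case: cN.
  by move=> c _ _ [x Nx <-] [y Ny <-]; exists (c *: x + y) => //; exact: (csubZD cN).
have pN' a (x : csubalg_type W) : N' (mulL (rho a) (val x)).
  apply: subset_closure; exists (mulL (restrict W (rho a)) x).
    by apply: sub_closed_span; exists a, x.
  by rewrite val_restrict//; exact: stabilizes_pi.
have pW a b (x : csubalg_type W) : W (mulL (rho a) b ** val x).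
  have [Yx Ysx] := csubalg_valP x; split; first exact/range_amul/range_ideal_gen.
  by rewrite /= starM; exact: range_amul.
have YN' y (x : csubalg_type W) : Y y -> N' (y ** val x).
  apply: (closed_span_sub (W := [set y | N' (y ** val x)])).
    apply: (csub_preim (s := id) (k := `|val x|) cN') => //.
    - by move=> z t; rewrite amulDl.
    - by move=> c z; rewrite amulZl.
    - by move=> z; rewrite mulrC normAM_le.
  move=> _ [a [b ->]] /=.
  have := @closed_span_product _ _ a.
  apply: (closed_span_sub (W := [set a | N' (mulL (rho a) b ** val x)])).
    apply: (csub_preim (s := id) (k := `|b| * `|val x|) cN') => //.
    - by move=> c d; rewrite (star_homD hrho) mulL_add amulDl.
    - by move=> c d; rewrite (star_homZ hrho) mulL_scale amulZl.
    - move=> c; apply: le_trans (normAM_le _ _) _.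
      by rewrite mulrAC ler_wpM2r// mulrC star_hom_le.
  move=> _ [c [d ->]] /=.
  rewrite (star_homM hrho) mulL_mul -mulLM -(val_to_csubalg (pW d b x)).
  exact: pN'.
apply/seteqP; split => // x _.
have N'x : N' (val x).
  have := @closed_span_product _ _ x.
  apply: (closed_span_sub (W := [set x : csubalg_type W | N' (val x)])).
    by apply: (csub_preim (s := id) (k := 1) cN') => // z; rewrite mul1r.
  move=> _ [y [z ->]] /=; apply: YN'.
  by have [] := csubalg_valP y.
apply: (csub_cl cN) => e e0; have /closure_normP/(_ _ e0)[_ [y Ny <-] xy] := N'x.
by exists y => //; rewrite csubalg_normE raddfB.
Qed.

End RangeIdeal.

(** * Universality for degenerate covariant homomorphisms *)

Theorem corollary3p13 (R : realType) (G : lcGroupType) (CG : groupCStar R G)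
    (A : cstarAlgType R) (alpha : G -> A -> A) (halpha : is_action alpha)
    (X : cstarAlgType R) (iA : A -> multiplier X) (iG : G -> multiplier X)
    (iGC : gc_alg CG -> multiplier X)
    (hX : is_crossed_product alpha iA iG iGC)
    (B : cstarAlgType R) (pi : A -> multiplier B) (u : G -> multiplier B)
    (uC : gc_alg CG -> multiplier B)
    (hpiu : covariant_hom alpha pi u) (huC : integrated_form u uC) :
  exists! Phi : X -> multiplier B,
    star_hom Phi /\
    forall (a : A) (c : gc_alg CG) (x : X),
      membed x = iA a ** iGC c -> Phi x = pi a ** uC c.
Proof.
have [hpi hu cov] := hpiu; have [huCh _] := huC.
set Y := @range_ideal R A B pi; set W := range_alg (rho := pi).
have cY : csub Y by exact: csub_range.
have Yu s y : Y y -> Y (mulL (u s) y).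
  apply: (range_stable (f := mulL (u s)) (s := id) (k := 1)) => //.
  - exact: mulLD.
  - exact: mulLZ.
  - by move=> b; rewrite mul1r unitary_norm// (uhom_unitaryl hu).
  (* Covariance moves [u s] past [pi a], at the cost of replacing [a] by [alpha s a]. *)
  move=> a b; have -> : mulL (u s) (mulL (pi a) b) =
      mulL (pi (alpha s a)) (mulL (u s) b).
    by rewrite cov -!mulL_mul -!amulA (uhom_unitaryl hu) mulm1.
  exact: range_ideal_gen.
have u1 : u 1%g = mone.
  by rewrite -[LHS]mul1m -(uhom_unitaryl hu 1%g) -amulA -(uhomM hu) mulg1.
have us s : star (u s) = u (s^-1)%g.
  by rewrite -[LHS]mulm1 -u1 -(mulgV s) (uhomM hu) amulA (uhom_unitaryl hu) mul1m.
have YuC c y : Y y -> Y (mulL (uC c) y).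
  by move=> Yy; apply: (integrated_form_csub huC cY) => s; exact: Yu.
have su s : stabilizes W (u s).
  apply: (stabilizes_range (k := 1)) => // [b|y|y].
  - by rewrite mul1r unitary_norm// (uhom_unitaryl hu).
  - exact: Yu.
  - by rewrite us; exact: Yu.
have sC c : stabilizes W (uC c).
  apply: (stabilizes_range (normr_ge0 c)) => [b|y|y].
  - exact: star_hom_le.
  - exact: YuC.
  - by rewrite -(star_homS huCh); exact: YuC.
have [Phi0 [[hPhi0 Phi0E] _]] := cp_universal hX
  (restrict_covariant (stabilizes_pi hpi) su hpiu)
  (restrict_nondegenerate hpi) (restrict_integrated_form su sC huC).
have gen a c x : membed x = iA a ** iGC c -> lifts Y Phi0 x (pi a ** uC c).
  move=> xE; have E := Phi0E _ _ _ xE.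
  have sT : stabilizes W (pi a ** uC c).
    by apply: stabilizesM => //; exact: stabilizes_pi.
  have {}E : Phi0 x = restrict W (pi a ** uC c).
    by rewrite E /= restrictM//; exact: stabilizes_pi.
  split=> [w|w|b|b].
  - by rewrite E val_restrict.
  - rewrite (star_homS hPhi0) E -restrict_star// val_restrict//.
    exact: stabilizes_star.
  - exact: range_ideal_gen.
  (* In the adjoint the factor from [pi] acts first, so the invariance of [Y] under [uC] is
     needed. *)
  - rewrite starM mulL_mul -(star_homS hpi) -(star_homS huCh).
    exact/YuC/range_ideal_gen.
have [|Phi hPhi PhiP] :=
    lift_star_hom cY (@range_alg_amul_star _ _ _ pi) hPhi0 (cp_span hX).
  by move=> x [a [c xE]]; exists (pi a ** uC c); exact: gen.
exists Phi; split.
  (* Both [Phi x] and [pi a ** uC c] lift [x], so they coincide. *)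
  split=> // a c x /gen; apply: lifts_uniq => //; exact: range_alg_amul_star.
move=> Psi [hPsi PsiE]; apply/funext => x; apply: multiplier_extL => b.
have : closed_span [set x | exists a c, membed x = iA a ** iGC c] x.
  by rewrite (cp_span hX).
(* Both homomorphisms are contractive, so the set where they agree on [b] is a closed subspace; it
   contains the generators of [X]. *)
apply: (closed_span_sub (W := [set x | mulL (Phi x) b = mulL (Psi x) b])).
  have := csub_preim (W := [set 0 : B]) (f := fun x => mulL (Phi x) b - mulL (Psi x) b)
    (s := id) (k := `|b| + `|b|) (csub_set0 B).
  rewrite (_ : _ @^-1` _ = [set x | mulL (Phi x) b = mulL (Psi x) b]); last first.
    apply/seteqP; split => z /=; last by move=> ->; rewrite subrr.
    by move=> /eqP; rewrite subr_eq0 => /eqP.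
  apply => // [z t|c z|z].
  - by rewrite (star_homD hPhi) (star_homD hPsi) !mulL_add opprD addrACA.
  - by rewrite (star_homZ hPhi) (star_homZ hPsi) !mulL_scale scalerBr.
  - apply: le_trans (ler_normB _ _) _.
    by rewrite mulrC mulrDr lerD// star_hom_le.
move=> z [a [c zE]] /=; rewrite (PsiE _ _ _ zE).
congr (mulL _ b); apply: lifts_uniq (PhiP z) (gen _ _ _ zE) => //.
exact: range_alg_amul_star.
Qed.
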